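(* Let $n>d\ge 2$ be positive integers, and let $\mathcal{F}$ be a finite family of $d$-dimensional lattice cones. There are, up to integral equivalence, finitely many lattice $d$-polytopes with at most $n$ lattice points on edges and such that every normal cone is equivalent to a cone from $\mathcal{F}$.
   Context: Let $M\cong\mathbb{Z}^d$ be a lattice, $N=\mathrm{Hom}(M,\mathbb{Z})$, $M_{\mathbb{R}}=M\otimes\mathbb{R}$, $N_{\mathbb{R}}=N\otimes\mathbb{R}$. A lattice $d$-polytope is a $d$-dimensional convex hull of finitely many points of $M$ in $M_{\mathbb{R}}$. Two lattice polytopes $P\subset M_{\mathbb{R}}$, $P'\subset M'_{\mathbb{R}}$ are integrally equivalent if there is an affine map $\mathrm{aff}\,P\to\mathrm{aff}\,P'$ mapping $M\cap\mathrm{aff}\,P$ bijectively onto $M'\cap\mathrm{aff}\,P'$ and $P$ onto $P'$. The normal cones of $P$ are the cones $\sigma(P,u)=\{v\in N_{\mathbb{R}}:\langle u'-u,v\rangle\ge 0\ \forall u'\in P\}$ for $u$ a vertex of $P$. A $d$-dimensional lattice cone is a full-dimensional pointed rational polyhedral cone in a $d$-dimensional real vector space with a lattice; two such cones are equivalent if a linear isomorphism, mapping one lattice bijectively onto the other, maps one cone onto the other. Lattice points on edges are the lattice points contained in the union of the one-dimensional faces. *)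

(* Defs.v *)
From HB Require Import structures.
From mathcomp Require Import all_boot all_order all_algebra.
From mathcomp Require Import boolp classical_sets functions cardinality reals.

Set Implicit Arguments.
Unset Strict Implicit.
Unset Printing Implicit Defensive.

Import Order.TTheory GRing.Theory Num.Theory.
Local Open Scope classical_set_scope.
Local Open Scope ring_scope.

(** Real vector spaces are [vectType]s over a [realType]; subsets of them
    (lattices, polytopes, cones) are classical sets. *)

Section Lattice.
Context {R : realType}.

(* A lattice M is given inside its real vector space V = M_R, as the Z-span of
   a basis of V. *)
Definition is_lattice (V : vectType R) (M : set V) : Prop :=
  exists X : (\dim {:V}).-tuple V,
    basis_of fullv X /\ M = [set v | inIntSpan X v].

(* N = Hom(M, Z), as the linear forms on M_R that are integral on M. *)
Definition dual_lattice (V : vectType R) (M : set V) : set 'Hom(V, R^o) :=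
  [set f | forall x, M x -> (f x : R) \is a Num.int].

End Lattice.

Section AffineGeometry.
Context {R : realType} {V : vectType R}.

Definition conv_hull (s : seq V) : set V :=
  [set x | exists c : 'I_(size s) -> R,
    [/\ forall i, 0 <= c i, \sum_i c i = 1 & x = \sum_i c i *: s`_i]].

Definition cone_hull (s : seq V) : set V :=
  [set x | exists c : 'I_(size s) -> R,
    (forall i, 0 <= c i) /\ x = \sum_i c i *: s`_i].

Definition aff_hull (A : set V) : set V :=
  [set x | exists (k : nat) (y : 'I_k -> V) (c : 'I_k -> R),
    [/\ forall i, A (y i), \sum_i c i = 1 & x = \sum_i c i *: y i]].

(* The affine dimension of a nonempty set; the empty set has no dimension. *)
Definition has_dim (A : set V) (k : nat) : Prop :=
  exists (x : V) (U : {vspace V}),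
    \dim U = k /\ aff_hull A = [set x + w | w in [set w | w \in U]].

End AffineGeometry.

Section Polytopes.
Context {R : realType} {V : vectType R}.

Definition lattice_polytope (d : nat) (M : set V) (P : set V) : Prop :=
  has_dim P d /\
  exists s : seq V, (forall x, x \in s -> M x) /\ P = conv_hull s.

(* Nonempty faces of a polytope P: the subsets on which some linear form
   attains its minimum over P (the zero form gives P itself). *)
Definition is_face (P F : set V) : Prop :=
  exists f : 'Hom(V, R^o),
    F = [set x | P x /\ forall y, P y -> (f x : R) <= (f y : R)].

Definition is_vertex (P : set V) (u : V) : Prop := is_face P [set u].

Definition is_edge (P E : set V) : Prop := is_face P E /\ has_dim E 1.

Definition lattice_points_on_edges (M P : set V) : set V :=
  [set x | M x /\ exists2 E, is_edge P E & E x].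

Definition normal_cone (P : set V) (u : V) : set 'Hom(V, R^o) :=
  [set v | forall u', P u' -> 0 <= (v (u' - u) : R)].

(* A full-dimensional pointed rational polyhedral cone C in the
   d-dimensional space V with lattice M. *)
Definition lattice_cone (d : nat) (M C : set V) : Prop :=
  [/\ \dim {:V} = d, is_lattice M, has_dim C d,
      forall x, C x -> C (- x) -> x = 0 &
      exists s : seq V, (forall x, x \in s -> M x) /\ C = cone_hull s].

End Polytopes.

Section Equivalences.
Context {R : realType} {V V' : vectType R}.

(* Preserving binary affine combinations is enough for a map defined on an
   affine subspace to be affine. *)
Definition affine_on (A : set V) (f : V -> V') : Prop :=
  forall x y (t : R), A x -> A y ->
    f (t *: x + (1 - t) *: y) = t *: f x + (1 - t) *: f y.

(* Only the values of f on the affine hull of P matter. *)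
Definition integrally_equivalent (M : set V) (M' : set V')
    (P : set V) (P' : set V') : Prop :=
  exists f : V -> V',
    [/\ affine_on (aff_hull P) f,
        set_fun (aff_hull P) (aff_hull P') f,
        set_bij (M `&` aff_hull P) (M' `&` aff_hull P') f &
        f @` P = P'].

Definition cone_equivalent (M : set V) (C : set V)
    (M' : set V') (C' : set V') : Prop :=
  exists phi : 'Hom(V, V'),
    [/\ bijective phi, phi @` M = M' & phi @` C = C'].

End Equivalences.

(* Main.v *)
(** Fix a vertex [u0], an edge from [u0] to [u1] and a two-dimensional face [F]
    through it. Identifying the normal cone at a vertex with a cone of the family
    gives coordinates there in which the primitive edge directions, hence also
    the edge vectors, are bounded. The coordinates at [u0] and [u1] can differ
    only by a shear along the edge, and it suffices to bound the slope [s] of the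
    other edge of [F] at [u1] relative to the other edge at [u0]. It is bounded
    below because [F] contains a lattice point off the base [u0 u1]. It is
    bounded above because the slopes of the two edges of [F] at any vertex
    between the base and the top differ by a bounded amount, so that a large [s]
    would make [F] widen all the way up to its top edge, which is short. As the
    two-dimensional faces through an edge span the space, the change of
    coordinates along each edge is bounded; walking along the at most [n]
    vertices bounds the whole polytope in the coordinates at one vertex. *)

Require Import Defs.
From HB Require Import structures.
From mathcomp Require Import all_boot all_order all_algebra.
From mathcomp Require Import boolp classical_sets functions cardinality reals.
From mathcomp Require Import ring lra.

Set Implicit Arguments.
Unset Strict Implicit.
Unset Printing Implicit Defensive.

Import Order.TTheory GRing.Theory Num.Theory.
Local Open Scope classical_set_scope.
Local Open Scope ring_scope.

(** No face lattice is built. The polytope is replaced by the list [S] of its exposed points, an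
    edge by two points that some functional minimises alone, and a face by the points of [S] where a
    functional [nu] is least; tilting [nu] slightly passes to smaller faces. The obstacle is
    uniformity: constants may depend on the lattice, the family and [n], but not on the polytope.
    They are therefore chosen once for each of finitely many types (the set of cone generators
    vanishing on an edge, a set of integer coordinate vectors of edges) and then maximised. The
    count of lattice points on edges enters twice: it bounds the number of vertices, and it bounds
    the ratio of an edge vector to any lattice vector along it. Integrality enters through
    determinants: an edge pair at a vertex has bounded coordinates, hence a common denominator [D]
    serves all corners, and this is what limits the change of slope at a vertex. That the faces
    through an edge span the space is used dually: a nonzero functional constant on the edge is
    nonconstant on one of these faces. *)

Lemma seq_argmin (R : realFieldType) (T : eqType) (s : seq T) (F : T -> R) t0 :
  t0 \in s -> exists2 t, t \in s & forall u, u \in s -> F t <= F u.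
Proof.
elim: s t0 => // a s IHs t0 _.
case: s IHs => [|b s] IHs.
  by exists a; rewrite ?mem_head // => u; rewrite inE => /eqP->.
have [t ts tmin] := IHs b (mem_head _ _).
have [le_at|lt_ta] := lerP (F a) (F t).
  exists a; rewrite ?mem_head // => u; rewrite inE => /predU1P[->//|us].
  exact: le_trans le_at (tmin u us).
exists t => [|u]; first by rewrite in_cons ts orbT.
by rewrite in_cons => /predU1P[->|]; [apply: ltW | exact: tmin].
Qed.

Lemma small_perturbation (R : realFieldType) (T : eqType) (s : seq T)
    (a b : T -> R) :
  (forall t, t \in s -> 0 < a t) ->
  exists2 e, 0 < e & forall t, t \in s -> 0 < a t + e * b t.
Proof.
elim: s => [|t s IHs] a_gt0; first by exists 1.
have [e e_gt0 eP] := IHs (fun u us => a_gt0 u (@mem_behead _ (t :: s) u us)).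
have at_gt0 := a_gt0 t (mem_head _ _).
have D_gt0 : 0 < `|b t| + 1 by rewrite ltr_pwDr.
pose e' := Num.min e (a t / (`|b t| + 1)).
have e'_gt0 : 0 < e' by rewrite lt_min e_gt0 divr_gt0.
exists e' => // u; rewrite inE => /predU1P[->|us].
  have : e' * (`|b t| + 1) <= a t by rewrite -ler_pdivlMr // ge_min lexx orbT.
  have : - `|b t| <= b t by rewrite lerNl -normrN ler_norm.
  by nra.
have e'e : e' <= e by rewrite ge_min lexx.
have := eP u us; have := a_gt0 u (mem_behead (s := t :: s) us).
by have [] := ltP (b u) 0; nra.
Qed.

(** * Functionals and exposed rays *)

Section Functionals.
Context {R : realType} {V : vectType R}.
Implicit Types (f g : 'Hom(V, R^o)) (x y : V) (U : {vspace V}).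

Definition ev f x : R := f x.

Lemma evD f x y : ev f (x + y) = ev f x + ev f y. Proof. by rewrite /ev linearD. Qed.
Lemma evB f x y : ev f (x - y) = ev f x - ev f y. Proof. by rewrite /ev linearB. Qed.
Lemma evN f x : ev f (- x) = - ev f x. Proof. by rewrite /ev linearN. Qed.
Lemma evZ f a x : ev f (a *: x) = a * ev f x. Proof. by rewrite /ev linearZ. Qed.
Lemma ev0 f : ev f 0 = 0. Proof. by rewrite /ev linear0. Qed.
Lemma ev_sum (I : Type) (r : seq I) (P : pred I) f (F : I -> V) :
  ev f (\sum_(i <- r | P i) F i) = \sum_(i <- r | P i) ev f (F i).
Proof. by rewrite /ev linear_sum. Qed.
Lemma evDf f g x : ev (f + g) x = ev f x + ev g x.
Proof. by rewrite /ev add_lfunE. Qed.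
Lemma evNf f x : ev (- f) x = - ev f x. Proof. by rewrite /ev opp_lfunE. Qed.
Lemma evZf a f x : ev (a *: f) x = a * ev f x. Proof. by rewrite /ev scale_lfunE. Qed.
Lemma ev0f x : ev 0 x = 0. Proof. by rewrite /ev zero_lfunE. Qed.
Lemma ev_sumf (I : Type) (r : seq I) (P : pred I) (F : I -> 'Hom(V, R^o)) x :
  ev (\sum_(i <- r | P i) F i) x = \sum_(i <- r | P i) ev (F i) x.
Proof. by rewrite /ev sum_lfunE. Qed.

Definition evE := (evD, evB, evN, evZ, ev0, evDf, evNf, evZf, ev0f).

Definition vanishes_on f U := forall u, u \in U -> ev f u = 0.

Lemma separate_from_subspace U z :
  z \notin U -> exists2 f, vanishes_on f U & ev f z = 1.
Proof.
move=> zU.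
have nz : z - projv U z != 0.
  by apply: contraNneq zU => /eqP; rewrite subr_eq0 => /eqP ->; apply: memv_proj.
pose X := vbasis (fullv : {vspace V}).
have [i ni] : exists i, coord X i (z - projv U z) != 0.
  apply/existsP; apply: contraNT nz => /existsPn h.
  rewrite (coord_vbasis (memvf (z - projv U z))) big1 // => i _.
  by have := h i; rewrite negbK => /eqP->; rewrite scale0r.
pose c : V -> R^o := fun w => coord X i (w - projv U w).
have clin : linear c.
  by move=> a x y; rewrite /c (linearP (projv U)) opprD addrACA -scalerBr linearP.
pose cL : {linear V -> R^o} := HB.pack c (GRing.isLinear.Build _ _ _ _ c clin).
exists ((c z)^-1 *: linfun cL) => [u uU|].
  have cu : c u = 0 by rewrite /c projv_id // subrr linear0.
  by rewrite evZf /ev lfunE /= cu mulr0.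
by rewrite evZf /ev lfunE /= mulVf.
Qed.

Lemma functional_eq0 f : (forall x, ev f x = 0) -> f = 0.
Proof. by move=> f0; apply/lfunP => x; rewrite zero_lfunE; apply: f0. Qed.

Lemma vanishes_on_line f w : ev f w = 0 -> vanishes_on f <[w]>.
Proof. by move=> fw u /vlineP[k ->]; rewrite evZ fw mulr0. Qed.

Lemma vanishes_on0 f : vanishes_on f 0.
Proof. by move=> u; rewrite memv0 => /eqP->; rewrite ev0. Qed.

(* The simplex method in disguise: among the exposing functionals whose zero
   set lies in [f < 0] and is not inside [U], one with a smallest zero set
   exposes a single ray modulo [U]. *)
Lemma exposed_ray (s : seq V) U nu0 f w0 :
  vanishes_on nu0 U -> (forall w, w \in s -> w \notin U -> 0 < ev nu0 w) ->
  vanishes_on f U -> w0 \in s -> ev f w0 < 0 ->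
  exists w nu, [/\ w \in s, w \notin U, ev f w < 0, vanishes_on nu U &
    [/\ ev nu w = 0, forall w', w' \in s -> 0 <= ev nu w' &
        forall w', w' \in s -> ev nu w' = 0 -> w' \in (U + <[w]>)%VS]].
Proof.
move=> nu0U nu0_gt0 fU w0s fw0.
have notU g w : vanishes_on g U -> ev g w != 0 -> w \notin U.
  by move=> gU; apply: contra => /gU/eqP.
pose Z nu := [seq w <- s | (w \notin U) && (ev nu w == 0)].
have ZP nu w : (w \in Z nu) = [&& w \notin U, ev nu w == 0 & w \in s].
  by rewrite mem_filter andbA.
pose good nu := [/\ vanishes_on nu U, forall w, w \in s -> 0 <= ev nu w,
  forall w, w \in Z nu -> ev f w < 0 & exists w, w \in Z nu].
suff main m nu : good nu -> (size (Z nu) <= m)%N ->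
    exists w nu', [/\ w \in s, w \notin U, ev f w < 0, vanishes_on nu' U &
    [/\ ev nu' w = 0, forall w', w' \in s -> 0 <= ev nu' w' &
        forall w', w' \in s -> ev nu' w' = 0 -> w' \in (U + <[w]>)%VS]].
  have w0U : w0 \notin U by apply: notU fU _; rewrite lt_eqF.
  have w0f : w0 \in [seq w <- s | w \notin U] by rewrite mem_filter w0U.
  (* The ratio test: subtracting from [f] the least ratio times [nu0] leaves a functional that is
     nonnegative on [s], and at its zeros off [U] the value of [f] is a negative multiple of that of
     [nu0]. *)
  have [w1] := seq_argmin (fun w => ev f w / ev nu0 w) w0f.
  rewrite mem_filter => /andP[w1U w1s] w1min.
  set mm := ev f w1 / ev nu0 w1 in w1min.
  have mm_lt0 : mm < 0.
    apply: le_lt_trans (w1min _ w0f) _.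
    by rewrite ltr_pdivrMr ?mul0r // nu0_gt0.
  apply: (main _ (f - mm *: nu0)); last exact: leqnn.
  split.
  - by move=> u uU; rewrite !evE fU ?nu0U // mulr0 subrr.
  - move=> w ws; rewrite !evE.
    have [wU|wU] := boolP (w \in U); first by rewrite fU ?nu0U // mulr0 subrr.
    have := w1min w; rewrite mem_filter wU => /(_ ws).
    by rewrite ler_pdivlMr ?nu0_gt0 // subr_ge0.
  - move=> w; rewrite ZP => /and3P[wU + ws].
    rewrite !evE subr_eq0 => /eqP ->.
    by rewrite nmulr_rlt0 // nu0_gt0.
  - exists w1; rewrite ZP w1U w1s !evE /mm divfK ?subrr ?eqxx //.
    by rewrite gt_eqF // nu0_gt0.
elim: m nu => [|m IHm] nu [nuU nu_ge0 nuf [w wZ]] szZ.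
  by move: wZ; rewrite leqn0 size_eq0 in szZ *; rewrite (eqP szZ).
have := wZ; rewrite ZP => /and3P[wU /eqP nuw ws].
have [par|] := pselect (forall w', w' \in Z nu -> w' \in (U + <[w]>)%VS).
  exists w, nu; split=> //; first exact: nuf.
  split=> // w' w's nuw'.
  have [w'U|w'U] := boolP (w' \in U); last by apply: par; rewrite ZP w'U nuw' eqxx.
  by apply: (subvP (addvSl U <[w]>)).
move=> /existsNP[w' /not_implyP[w'Z /negP w'U]].
have := w'Z; rewrite ZP => /and3P[w'nU /eqP nuw' w's].
(* The aim is an [h] that is nonnegative on [Z nu] and vanishes somewhere on it, but not everywhere;
   then [nu + e *: h] has a smaller zero set. Since [nu0] kills [z], correcting [g] by a multiple of
   [nu0] keeps the value 1 at [z], so [h] cannot vanish at both [w] and [w']. *)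
pose z := ev nu0 w' *: w - ev nu0 w *: w'.
have nw : 0 < ev nu0 w by apply: nu0_gt0.
have nw' : 0 < ev nu0 w' by apply: nu0_gt0.
have zU : z \notin U.
  apply: contra w'U => zU.
  have -> : w' = (ev nu0 w)^-1 *: (- z) + ((ev nu0 w)^-1 * ev nu0 w') *: w.
    rewrite -scalerA -scalerDr opprB subrK scalerA mulVf ?scale1r //.
    by rewrite gt_eqF.
  by apply: memv_add; [rewrite memvZ // rpredN | rewrite memvZ // memv_line].
have [g gU gz] := separate_from_subspace zU.
have [w1 w1Z w1min] := seq_argmin (fun w => ev g w / ev nu0 w) wZ.
set mm := ev g w1 / ev nu0 w1 in w1min.
pose h := g - mm *: nu0.
have hU : vanishes_on h U.
  by move=> u uU; rewrite !evE gU ?nu0U // mulr0 subrr.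
have hZ u : u \in Z nu -> 0 <= ev h u.
  move=> uZ; have := w1min u uZ.
  have := uZ; rewrite ZP => /and3P[uU _ us].
  by rewrite !evE ler_pdivlMr ?nu0_gt0 // subr_ge0.
have := w1Z; rewrite ZP => /and3P[w1U /eqP nuw1 w1s].
have hw1 : ev h w1 = 0.
  by rewrite !evE /mm divfK ?subrr // gt_eqF // nu0_gt0.
have hz : ev h z = 1.
  rewrite /h evDf evNf evZf gz /z evB !evZ [_ * ev nu0 w']mulrC subrr.
  by rewrite mulr0 subr0.
clearbody h.
have [w2 w2Z hw2] : exists2 w2, w2 \in Z nu & 0 < ev h w2.
  have : ev h w != 0 \/ ev h w' != 0.
    have [hw0|] := eqVneq (ev h w) 0; last by left.
    right; apply/eqP => hw'0; move: hz; rewrite !evB !evZ.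
    by rewrite hw0 hw'0 !mulr0 subrr => /eqP; rewrite eq_sym oner_eq0.
  by case=> hn; [exists w | exists w'] => //; rewrite lt_neqAle eq_sym hn hZ.
have [|e e_gt0 eP] :=
  @small_perturbation _ _ [seq u <- s | 0 < ev nu u] (ev nu) (ev h).
  by move=> u; rewrite mem_filter => /andP[].
have h'P u : u \in s -> u \notin U ->
    0 < ev (nu + e *: h) u \/ (u \in Z nu /\ ev (nu + e *: h) u = e * ev h u).
  move=> us uU; have := nu_ge0 u us; rewrite le_eqVlt => /predU1P[nu0E|nu_gt0].
    right; split; first by rewrite ZP uU us -nu0E eqxx.
    by rewrite evDf evZf -nu0E add0r.
  by left; rewrite evDf evZf eP // mem_filter nu_gt0.
have ZZ u : u \in Z (nu + e *: h) -> u \in Z nu /\ ev h u = 0.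
  rewrite ZP => /and3P[uU /eqP h0 us].
  have [|[uZ]] := h'P u us uU; first by rewrite h0 ltxx.
  by rewrite h0 => /esym/eqP; rewrite mulf_eq0 gt_eqF //= => /eqP.
apply: (IHm (nu + e *: h)).
  split.
  - by move=> u uU; rewrite evDf evZf nuU ?hU // mulr0 addr0.
  - move=> u us; have [uU|uU] := boolP (u \in U).
      by rewrite evDf evZf nuU ?hU // mulr0 addr0.
    have [/ltW//|[uZ ->]] := h'P u us uU.
    by rewrite mulr_ge0 ?hZ // ltW.
  - by move=> u /ZZ[/nuf].
  - by exists w1; rewrite ZP w1U w1s evDf evZf nuw1 hw1 mulr0 addr0 eqxx.
have -> : Z (nu + e *: h) = [seq u <- Z nu | ev h u == 0].
  rewrite /Z -filter_predI; apply: eq_in_filter => u us /=.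
  have [uU|uU] := boolP (u \in U); rewrite ?andbF ?andbT //=.
  have [h_gt0|[uZ ->]] := h'P u us uU.
    rewrite gt_eqF //; apply/esym/negbTE; apply: contraTN h_gt0.
    by move=> /andP[/eqP h0 /eqP n0]; rewrite evDf evZf h0 n0 mulr0 addr0 ltxx.
  rewrite mulf_eq0 gt_eqF //=.
  by have := uZ; rewrite ZP => /and3P[_ -> _]; rewrite andbT.
rewrite -ltnS; apply: leq_trans szZ.
rewrite size_filter ltn_neqAle count_size andbT -all_count.
by apply/allPn; exists w2 => //; rewrite gt_eqF.
Qed.

End Functionals.

(** * Convex hulls and their exposed points *)

Section ConvexHulls.
Context {R : realType} {V : vectType R}.
Implicit Types (s S : seq V) (x v : V).

(** Gordan's alternative, by eliminating one vector at a time: if the functional found for the rest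
    is negative at the new vector, the others are moved along that vector into the kernel of the
    functional and the induction is applied again. *)
Lemma gordan (T : eqType) (s : seq T) (w : T -> V) : uniq s ->
  (exists f, forall t, t \in s -> 0 < ev f (w t)) \/
  (exists c : T -> R, [/\ forall t, 0 <= c t, exists2 t, t \in s & 0 < c t &
     \sum_(t <- s) c t *: w t = 0]).
Proof.
elim: s w => [|t s IHs] w; first by left; exists 0.
move=> /= /andP[ts us].
have sum_if (a : R) (c : T -> R) :
    \sum_(u <- s) (if u == t then a else c u) *: w u = \sum_(u <- s) c u *: w u.
  by apply: eq_big_seq => u us'; case: eqP ts us' => // -> /negbTE ->.
have neq_t u : u \in s -> (u == t) = false.
  by move=> us'; apply: contraNF ts => /eqP <-.
have [wt0|wt_n0] := eqVneq (w t) 0.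
  right; exists (fun u => if u == t then 1 else 0); split.
  - by move=> u; case: ifP.
  - by exists t; rewrite ?mem_head // eqxx.
  - by rewrite big_cons sum_if eqxx wt0 scaler0 add0r big1 // => u _; rewrite scale0r.
have [[f fP]|[c [c_ge0 [u us' cu] csum]]] := IHs w us; last first.
  right; exists (fun u => if u == t then 0 else c u); split.
  - by move=> u'; case: ifP.
  - by exists u; rewrite ?inE ?us' ?orbT // neq_t.
  - by rewrite big_cons sum_if eqxx scale0r add0r.
have [ft|ft|ft] := ltgtP (ev f (w t)) 0; last 2 first.
- by left; exists f => u; rewrite inE => /predU1P[->|/fP].
- have [|g _ gt1] := @separate_from_subspace _ _ 0%VS (w t).
    by rewrite memv0.
  have [e e_gt0 eP] := @small_perturbation _ _ s (ev f \o w) (ev g \o w) fP.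
  left; exists (f + e *: g) => u.
  rewrite inE => /predU1P[->|us']; rewrite evDf evZf; last exact: eP.
  by rewrite ft gt1 add0r mulr1.
pose w' u := ev f (w u) *: w t - ev f (w t) *: w u.
have [[g gP]|[c [c_ge0 [u us' cu] csum]]] := IHs w' us; last first.
  right; exists (fun t' => if t' == t then \sum_(u <- s) c u * ev f (w u)
                           else - ev f (w t) * c t'); split.
  - move=> t'; case: ifP => _; last by rewrite mulr_ge0 // oppr_ge0 ltW.
    by rewrite big_seq sumr_ge0 // => u' us''; rewrite mulr_ge0 // ltW // fP.
  - by exists u; rewrite ?inE ?us' ?orbT // neq_t // mulr_gt0 // oppr_gt0.
  - rewrite big_cons sum_if eqxx -[RHS]csum scaler_suml -big_split /=.
    apply: eq_bigr => t' _; rewrite /w' scalerBr !scalerA mulNr scaleNr.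
    by rewrite [c t' * ev f (w t)]mulrC.
(* With this [b], [g + b *: f] vanishes at [w t] and is positive on the rest; subtracting a small
   multiple of [f] makes it positive at [w t] as well. *)
pose b := ev g (w t) / - ev f (w t).
have [|e e_gt0 eP] := @small_perturbation _ _ s (ev (g + b *: f) \o w) (fun u => - ev f (w u)).
  move=> u us'; rewrite /= evDf evZf /b.
  have := gP u us'; rewrite /w' evB !evZ => h.
  rewrite -(pmulr_lgt0 _ (_ : 0 < - ev f (w t))) ?oppr_gt0 //.
  rewrite mulrDl mulrAC divfK ?oppr_eq0 ?lt_eqF //; nra.
left; exists (g + b *: f - e *: f) => u.
rewrite inE => /predU1P[->|us']; rewrite !evDf evNf !evZf; last first.
  by have := eP u us'; rewrite /= evDf evZf mulrN.
rewrite /b mulrAC -mulrA invrN mulrN divff ?lt_eqF // mulrN1 subrr add0r.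
by rewrite oppr_gt0 pmulr_rlt0.
Qed.

(** Coefficients are indexed by vectors instead of positions, so that removing or permuting points
    needs no reindexing; this suits lists without repetition. *)
Definition hull S x := exists c : V -> R,
  [/\ forall v, 0 <= c v, \sum_(v <- S) c v = 1 & x = \sum_(v <- S) c v *: v].

Lemma hull_mem S v : uniq S -> v \in S -> hull S v.
Proof.
move=> uS vS; exists (fun u => (u == v)%:R); split=> [u||].
- by rewrite ler0n.
- rewrite (bigD1_seq v) //= eqxx big1 ?addr0 // => u /negbTE ->//.
- rewrite (bigD1_seq v) //= eqxx big1 ?addr0 ?scale1r // => u /negbTE ->.
  by rewrite scale0r.
Qed.

Lemma pick_sum (W : nmodType) (r : seq V) v0 (F : V -> W) : uniq r -> v0 \in r ->
  \sum_(v <- r) (if v0 == v then F v else 0) = F v0.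
Proof.
move=> ur vr; rewrite (bigD1_seq v0) //= eqxx big1 ?addr0 // => v.
by rewrite eq_sym => /negbTE ->.
Qed.

Lemma conv_hullP s x : conv_hull s x <-> hull (undup s) x.
Proof.
have undup_sum (W : zmodType) (F : V -> W) :
    \sum_(v <- s) F v = \sum_(v <- undup s) F v *+ count_mem v s.
  rewrite -big_undup_iterop_count /=; apply: eq_bigr => v _.
  by rewrite Monoid.iteropE /= iter_addr_0.
have nth_sum (W : zmodType) (F : V -> W) :
    \sum_(i < size s) F s`_i = \sum_(v <- s) F v.
  by rewrite (big_nth 0) big_mkord.
split=> [[c [c_ge0 c1 ->]]|[c [c_ge0 c1 ->]]].
  exists (fun v => \sum_(i < size s | s`_i == v) c i); split.
  - by move=> v; apply: sumr_ge0.
  - rewrite -c1; under eq_bigr do rewrite big_mkcond; rewrite exchange_big /=.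
    by apply: eq_bigr => i _; rewrite pick_sum ?mem_undup ?mem_nth ?undup_uniq.
  - under [RHS]eq_bigr do rewrite scaler_suml big_mkcond; rewrite exchange_big /=.
    by apply: eq_bigr => i _; rewrite pick_sum ?mem_undup ?mem_nth ?undup_uniq.
have cnt v : v \in undup s -> ((count_mem v s)%:R : R) != 0.
  by rewrite mem_undup => vs; rewrite pnatr_eq0 -lt0n -has_count has_pred1.
(* A repeated point shares its coefficient equally among its occurrences. *)
exists (fun i : 'I_(size s) => c s`_i / (count_mem s`_i s)%:R); split.
- by move=> i; rewrite divr_ge0 ?ler0n.
- have /= -> := nth_sum _ (fun v => c v / (count_mem v s)%:R).
  rewrite undup_sum -[RHS]c1.
  by apply: eq_big_seq => v /cnt nv /=; rewrite -[c v / _ *+ _]mulr_natr divfK.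
- have /= -> := nth_sum _ (fun v => (c v / (count_mem v s)%:R) *: v).
  rewrite undup_sum.
  by apply: eq_big_seq => v /cnt nv /=; rewrite scalerMnl -[c v / _ *+ _]mulr_natr divfK.
Qed.

Definition exposed S v :=
  exists f, forall u, u \in S -> u != v -> ev f v < ev f u.

Lemma hull_rem S v x : uniq S -> v \in S -> hull (rem v S) x -> hull S x.
Proof.
move=> uS vS [c [c_ge0 c1 ->]].
have neq u : u \in rem v S -> (u == v) = false.
  by move=> h; apply/negP => /eqP e; move: h; rewrite e mem_rem_uniqF.
exists (fun u => if u == v then 0 else c u); split.
- by move=> u; case: ifP.
- rewrite (perm_big _ (perm_to_rem vS)) big_cons /= eqxx add0r -c1.
  by apply: eq_big_seq => u /neq ->.
- rewrite (perm_big _ (perm_to_rem vS)) big_cons /= eqxx scale0r add0r.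
  by apply: eq_big_seq => u /neq ->.
Qed.

(** As no functional is positive on all [u - v], Gordan's alternative gives a nonnegative relation
    among them. It writes [v] as a convex combination of the other points, over which the weight of
    [v] is redistributed. *)
Lemma hull_remove_unexposed S v x : uniq S -> v \in S -> ~ exposed S v ->
  hull S x -> hull (rem v S) x.
Proof.
move=> uS vS nexp [a [a_ge0 a1 ->]].
have [[f fP]|[c [c_ge0 [u us cu] csum]]] :=
    gordan (fun u => u - v) (rem_uniq v uS).
  case: nexp; exists f => u sS sv.
  by have := fP u; rewrite mem_rem_uniq // inE sv sS evB subr_gt0 => ->.
pose C := \sum_(t <- rem v S) c t.
have C_gt0 : 0 < C.
  rewrite /C (bigD1_seq u) ?rem_uniq //=.
  by rewrite ltr_pwDl // sumr_ge0.
have vE : v = \sum_(t <- rem v S) (c t / C) *: t.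
  have /scalerI : C != 0 by rewrite gt_eqF.
  apply; rewrite scaler_sumr.
  under eq_bigr do rewrite scalerA mulrCA divff ?gt_eqF // mulr1.
  apply/esym/eqP; rewrite -subr_eq0 -[X in _ == X]csum scaler_suml -sumrB.
  by apply/eqP; apply: eq_bigr => t _; rewrite scalerBr.
exists (fun t => a t + a v * (c t / C)); split.
- by move=> t; rewrite addr_ge0 // mulr_ge0 // divr_ge0 // ltW.
- rewrite big_split /= -mulr_sumr -mulr_suml divff ?gt_eqF // mulr1 addrC.
  by rewrite -a1 [RHS](perm_big _ (perm_to_rem vS)) big_cons.
- rewrite (perm_big _ (perm_to_rem vS)) big_cons /= addrC.
  under [RHS]eq_bigr do rewrite scalerDl -scalerA.
  by rewrite big_split /= -scaler_sumr -vE.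
Qed.

Lemma hull_of_exposed S : uniq S -> exists S', [/\ uniq S', {subset S' <= S},
  forall v, v \in S' -> exposed S' v & forall x, hull S x <-> hull S' x].
Proof.
have [m] := ubnP (size S); elim: m S => // m IHm S szS uS.
have [allexp|] := pselect (forall v, v \in S -> exposed S v); first by exists S; split.
move=> /existsNP[v /not_implyP[vS nexp]].
have [||S' [uS' subS' expS' hullS']] := IHm (rem v S).
- by rewrite size_rem // -ltnS prednK //; case: (S) vS.
- exact: rem_uniq.
exists S'; split=> // [u /subS'/mem_rem//|x].
by rewrite -hullS'; split; [exact: hull_remove_unexposed | exact: hull_rem].
Qed.

End ConvexHulls.

(** * Edges and two-dimensional faces *)

Section Edges.
Context {R : realType} {V : vectType R}.
Implicit Types (S : seq V) (v w : V) (f nu : 'Hom(V, R^o)).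

Definition adjacent S v w := [/\ v \in S, w \in S, v != w &
  exists f, ev f v = ev f w /\
    forall u, u \in S -> u != v -> u != w -> ev f v < ev f u].

Lemma adjacent_sym S v w : adjacent S v w -> adjacent S w v.
Proof.
move=> [vS wS vw [f [fvw fS]]]; split; rewrite 1?eq_sym //.
by exists f; split=> // u uS uw uv; rewrite -fvw fS.
Qed.

(** Of three distinct collinear points one lies between the other two, and no functional has its
    strict minimum there; the position of [l] relative to 0 and 1 tells which one it is. *)
Lemma exposed_collinear S a b c (l : R) : (forall v, v \in S -> exposed S v) ->
  a \in S -> b \in S -> c \in S -> a != b -> c - a = l *: (b - a) ->
  c = a \/ c = b.
Proof.
move=> expS aS bS cS ab cE.
have [->|ca] := eqVneq c a; first by left.
have [->|cb] := eqVneq c b; first by right.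
exfalso; have cf f : ev f c - ev f a = l * (ev f b - ev f a) by rewrite -!evB cE evZ.
have [l0|l0] := ltP l 0.
  have [f fS] := expS a aS; have := cf f.
  have := fS c cS ca; have := fS b bS; rewrite eq_sym => /(_ ab); nra.
have [l1|l1] := ltP l 1.
  have [f fS] := expS c cS; have := cf f.
  have := fS a aS; have := fS b bS; rewrite ![_ == c]eq_sym => /(_ cb) + /(_ ca).
  by nra.
have [f fS] := expS b bS; have := cf f.
by have := fS a aS ab; have := fS c cS cb; nra.
Qed.

(** A simplex step inside the face of [nu]: the differences to [v] generate the cone of the face at
    [v], the functional exposing [v] shows that it is pointed, and an exposed ray where [f] is
    negative is the edge. *)
Lemma edge_in_face S nu v f u : (forall w, w \in S -> exposed S w) ->
  v \in S -> (forall s, s \in S -> ev nu v <= ev nu s) ->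
  u \in S -> ev nu u = ev nu v -> ev f u < ev f v ->
  exists w, [/\ adjacent S v w, ev nu w = ev nu v & ev f w < ev f v].
Proof.
move=> expS vS nuS uS nuu fu; have [f0 f0S] := expS v vS.
pose F := [seq s - v | s <- S & ev nu s == ev nu v].
have FP z : z \in F -> exists2 s, s \in S & ev nu s = ev nu v /\ z = s - v.
  by move=> /mapP[s]; rewrite mem_filter => /andP[/eqP ? ?] ->; exists s.
have inF s : s \in S -> ev nu s = ev nu v -> s - v \in F.
  by move=> sS nus; apply: map_f; rewrite mem_filter nus eqxx.
have [|||w [g [/FP[w' w'S [nuw' ->]]]]] :=
    @exposed_ray _ _ F 0%VS f0 f (u - v) (@vanishes_on0 _ _ _) _ (@vanishes_on0 _ _ _).
- move=> z /FP[s sS [nus ->]]; rewrite memv0 subr_eq0 => sv.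
  by rewrite evB subr_gt0 f0S.
- exact: inF.
- by rewrite evB subr_lt0.
rewrite memv0 subr_eq0 evB subr_lt0 => w'v fw' _.
rewrite evB add0v => -[/eqP]; rewrite subr_eq0 => /eqP gw' gF gF0.
exists w'; split=> //; split=> //; first by rewrite eq_sym.
(* For small [e], tilting by [g] keeps the points off the face above [v]; on the face, [g] singles
   out a line, which contains no point of [S] besides [v] and [w']. *)
have [|e e_gt0 eP] := @small_perturbation _ _ [seq s <- S | ev nu s != ev nu v]
    (fun s => ev nu s - ev nu v) (fun s => ev g s - ev g v).
  move=> s; rewrite mem_filter => /andP[ns sS].
  by rewrite subr_gt0 lt_neqAle eq_sym ns nuS.
exists (nu + e *: g); rewrite !evDf !evZf nuw' gw'; split=> // s sS sv sw'.
rewrite evDf evZf; have [nus|nus] := eqVneq (ev nu s) (ev nu v); last first.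
  have := eP s; rewrite mem_filter nus sS => /(_ isT); lra.
rewrite nus ltrD2l ltr_pM2l //.
have := gF _ (inF s sS nus); rewrite evB subr_ge0 le_eqVlt => /predU1P[gs|//].
have := gF0 _ (inF s sS nus); rewrite evB -gs subrr => /(_ erefl) /vlineP[l sE].
have vw' : v != w' by rewrite eq_sym.
have [sv'|sw''] := exposed_collinear expS vS w'S sS vw' sE.
  by rewrite sv' eqxx in sv.
by rewrite sw'' eqxx in sw'.
Qed.

Lemma exists_edge S v u : (forall w, w \in S -> exposed S w) ->
  v \in S -> u \in S -> u != v -> exists w, adjacent S v w.
Proof.
move=> expS vS uS uv; have [f fS] := expS v vS.
have [||||w [? _ _]] := @edge_in_face S 0 v (- f) u expS vS.
- by move=> s _; rewrite !ev0f.
- by [].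
- by rewrite !ev0f.
- by rewrite !evNf ltrN2 fS.
by exists w.
Qed.

End Edges.

(** * The slope bound inside one two-dimensional face *)

Section TwoFace.
Context {R : realType} {V : vectType R} (M : set V) (S : seq V) (n D : nat).

Hypothesis expS : forall v, v \in S -> exposed S v.
Hypothesis sizeS : (size S <= n)%N.
Hypothesis latticeS : forall v w, v \in S -> w \in S -> M (w - v).
Hypothesis lengthS : forall v w z (r : R),
  adjacent S v w -> M z -> w - v = r *: z -> r < n%:R.
Hypothesis D_gt0 : (0 < D)%N.
(** Two edge vectors at a vertex need not generate the lattice of their plane; [D] is a common
    denominator for all such corners. *)
Hypothesis cornerS : forall v a b (k l : R), adjacent S v a -> adjacent S v b ->
  b - v \notin <[a - v]>%VS -> M (k *: (a - v) + l *: (b - v)) ->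
  D%:R * k \is a Num.int /\ D%:R * l \is a Num.int.

(** Relative to [u0], the point [u1] has coordinates (1, 0) and [s0] has (0, 1): the base is
    horizontal, the left edge vertical, and the right edge runs from [u1] to [s1]. *)
Context (u0 u1 s0 s1 : V) (nu x y : 'Hom(V, R^o)).
Hypothesis adj01 : adjacent S u0 u1.
Hypothesis adj0 : adjacent S u0 s0.
Hypothesis adj1 : adjacent S u1 s1.
Hypothesis nuS : forall s, s \in S -> ev nu u0 <= ev nu s.

Let F s := s \in S /\ ev nu s = ev nu u0.
Hypothesis Fu1 : ev nu u1 = ev nu u0.
Hypothesis Fs0 : ev nu s0 = ev nu u0.
Hypothesis Fs1 : ev nu s1 = ev nu u0.
Hypothesis x1 : ev x (u1 - u0) = 1.
Hypothesis x0 : ev x (s0 - u0) = 0.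
Hypothesis y1 : ev y (u1 - u0) = 0.
Hypothesis y0 : ev y (s0 - u0) = 1.
Hypothesis planeS : forall s, s \in S -> ev nu s = ev nu u0 ->
  s - u0 = ev x (s - u0) *: (u1 - u0) + ev y (s - u0) *: (s0 - u0).
Hypothesis y_s1 : 0 < ev y (s1 - u1).

Let xu1 : ev x u1 = ev x u0 + 1. Proof. by move: x1; rewrite evB; lra. Qed.
Let xs0 : ev x s0 = ev x u0. Proof. by move: x0; rewrite evB; lra. Qed.
Let yu1 : ev y u1 = ev y u0. Proof. by move: y1; rewrite evB; lra. Qed.
Let ys0 : ev y s0 = ev y u0 + 1. Proof. by move: y0; rewrite evB; lra. Qed.
Let ys1 : ev y u0 < ev y s1. Proof. by move: y_s1; rewrite evB yu1; lra. Qed.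
Let inF0 : F u0. Proof. by case: adj01. Qed.
Let inF1 : F u1. Proof. by case: adj01. Qed.
Let inFs0 : F s0. Proof. by case: adj0. Qed.
Let inFs1 : F s1. Proof. by case: adj1. Qed.

Let F_eq s t : F s -> F t ->
  s - t = (ev x s - ev x t) *: (u1 - u0) + (ev y s - ev y t) *: (s0 - u0).
Proof.
move=> [sS Fs] [tS Ft].
have -> : s - t = (s - u0) - (t - u0) by rewrite opprB addrA subrK.
rewrite {1}(planeS sS Fs) {1}(planeS tS Ft) opprD addrACA -!scalerBl !evB.
by congr (_ *: _ + _ *: _); lra.
Qed.

Let F_ev f s t : F s -> F t -> ev f s - ev f t =
  (ev x s - ev x t) * (ev f u1 - ev f u0) + (ev y s - ev y t) * (ev f s0 - ev f u0).
Proof. by move=> Fs Ft; rewrite -evB (F_eq Fs Ft) evD !evZ !evB. Qed.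

Let neq_y (a b : V) : ev y a != ev y b -> a != b.
Proof. by apply: contra => /eqP->. Qed.

Let above_base s : F s -> ev y u0 <= ev y s.
Proof.
move=> Fs; have [_ _ _ [f [f01 fS]]] := adj01.
have [->|su0] := eqVneq s u0; first exact: lexx.
have [->|su1] := eqVneq s u1; first by rewrite yu1.
have := F_ev f Fs inF0; have := fS s Fs.1 su0 su1.
have [s0S _] := inFs0; have := fS s0 s0S.
rewrite !neq_y ?ys0 ?yu1 ?gt_eqF ?ltrDl // => /(_ isT isT); nra.
Qed.

Let right_of_left_edge s : F s -> ev x u0 <= ev x s.
Proof.
move=> Fs; have [_ _ _ [f [f01 fS]]] := adj0.
have [->|su0] := eqVneq s u0; first exact: lexx.
have [->|su1] := eqVneq s s0; first by rewrite xs0.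
have := F_ev f Fs inF0; have := fS s Fs.1 su0 su1.
have [u1S _] := inF1; have := fS u1 u1S.
have -> : u1 != u0 by case: adj01 => _ _; rewrite eq_sym.
rewrite neq_y ?ys0 ?yu1 ?lt_eqF ?ltrDl // => /(_ isT isT); nra.
Qed.

(** Slopes are horizontal run per unit of height, so the left edge has slope 0 and [sigma] is the
    slope to be bounded. *)
Let sigma := (ev x s1 - ev x u1) / (ev y s1 - ev y u1).

Let sigmaE : ev x s1 - ev x u1 = sigma * (ev y s1 - ev y u0).
Proof. by rewrite /sigma yu1 divfK // subr_eq0 gt_eqF. Qed.

Let left_of_right_edge s : F s ->
  ev x s - ev x u1 <= sigma * (ev y s - ev y u0).
Proof.
move=> Fs; have [_ _ _ [f [f01 fS]]] := adj1.
have E := F_ev f inFs1 inF1; rewrite -f01 subrr sigmaE yu1 in E.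
have Y : 0 < ev y s1 - ev y u0 by rewrite subr_gt0.
have {}E : sigma * (ev f u1 - ev f u0) + (ev f s0 - ev f u0) = 0.
  apply: (mulfI (lt0r_neq0 Y)); rewrite mulr0 E; ring.
have [->|su1] := eqVneq s u1; first by rewrite yu1 !subrr mulr0.
have [->|ss1] := eqVneq s s1; first by rewrite sigmaE.
have := F_ev f Fs inF1; have := fS s Fs.1 su1 ss1; rewrite yu1.
have [u0S _] := inF0; have := fS u0 u0S.
have -> : u0 != u1 by case: adj01.
rewrite neq_y ?lt_eqF // => /(_ isT isT) f0 fs Es.
have E' : ev f s0 - ev f u0 = - (sigma * (ev f u1 - ev f u0)) by lra.
rewrite E' in Es.
suff : 0 < (sigma * (ev y s - ev y u0) - (ev x s - ev x u1)) * (ev f u0 - ev f u1).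
  by rewrite pmulr_lgt0 ?subr_gt0 // => /ltW.
have -> : (sigma * (ev y s - ev y u0) - (ev x s - ev x u1)) * (ev f u0 - ev f u1)
  = ev f s - ev f u1 by rewrite Es; ring.
by rewrite subr_gt0.
Qed.

(** The point [s0], at height 1 straight above [u0], must not lie to the right of the line through
    the right edge. *)
Let sigma_ge : -1 <= sigma.
Proof. by have := left_of_right_edge inFs0; rewrite xu1 xs0 ys0; lra. Qed.

Let det (v a b : V) := (ev x a - ev x v) * (ev y b - ev y v) -
                       (ev x b - ev x v) * (ev y a - ev y v).

(* [det] is 1 on the corner [u0], and the edge vectors at [u0] have
   coordinates in (1/D)Z with respect to those at [v]. *)
Let det_corner v a b : F v -> F a -> F b -> adjacent S v a -> adjacent S v b ->
  det v a b != 0 -> `|det v a b| <= D%:R ^+ 2.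
Proof.
move=> Fv Fa Fb va vb W0; set W := det v a b in W0 *.
have indep : b - v \notin <[a - v]>%VS.
  apply: contra W0 => /vlineP[k bE]; rewrite /W /det -!evB bE !evZ.
  by apply/eqP; ring.
have M01 : M (u1 - u0) by apply: latticeS; [case: inF0 | case: inF1].
have M00 : M (s0 - u0) by apply: latticeS; [case: inF0 | case: inFs0].
have comb p q : ((p * (ev y b - ev y v) - q * (ev x b - ev x v)) / W) *: (a - v)
    + ((q * (ev x a - ev x v) - p * (ev y a - ev y v)) / W) *: (b - v)
    = p *: (u1 - u0) + q *: (s0 - u0).
  rewrite (F_eq Fa Fv) (F_eq Fb Fv); move: (u1 - u0) (s0 - u0) => e g.
  rewrite !scalerDr !scalerA addrACA -!scalerDl.
  by congr (_ *: _ + _ *: _); move: W0; rewrite /W /det => W0; field.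
have := comb 1 0; rewrite scale1r scale0r addr0 !mul1r !mul0r subr0 sub0r => c1.
have := comb 0 1; rewrite scale1r scale0r add0r !mul1r !mul0r subr0 sub0r => c0.
have [|i1 i2] := cornerS va vb indep (k := (ev y b - ev y v) / W)
  (l := - (ev y a - ev y v) / W); first by rewrite c1.
have [|i3 i4] := cornerS va vb indep (k := - (ev x b - ev x v) / W)
  (l := (ev x a - ev x v) / W); first by rewrite c0.
(* This is the determinant of the matrix of [D] times the coordinates of [u1 - u0] and [s0 - u0] in
   the corner at [v]. Its entries are integers, so being nonzero it is at least 1 in absolute
   value. *)
have zi : D%:R ^+ 2 / W \is a Num.int.
  have -> : D%:R ^+ 2 / W =
    D%:R * ((ev x a - ev x v) / W) * (D%:R * ((ev y b - ev y v) / W)) -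
    D%:R * (- (ev x b - ev x v) / W) * (D%:R * (- (ev y a - ev y v) / W)).
    by move: W0; rewrite /W /det => W0; field.
  by rewrite rpredB // rpredM.
have D0 : (D%:R : R) != 0 by rewrite pnatr_eq0 -lt0n.
have := norm_intr_ge1 zi; rewrite mulf_neq0 ?expf_neq0 ?invr_eq0 // => /(_ isT).
by rewrite normrM normfV ler_pdivlMr ?normr_gt0 // mul1r normrX normr_nat.
Qed.

(** Height differences are coordinates of lattice vectors in the corner at [u0], hence lie in
    (1/D)Z. *)
Let y_step s t : F s -> F t -> ev y s < ev y t -> 1 <= D%:R * (ev y t - ev y s).
Proof.
move=> Fs Ft lt_st.
have indep : s0 - u0 \notin <[u1 - u0]>%VS.
  apply/negP => /vlineP[k E]; move: y0; rewrite E evZ y1 mulr0 => /eqP.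
  by rewrite eq_sym oner_eq0.
have [|_ yi] := cornerS adj01 adj0 indep (k := ev x t - ev x s) (l := ev y t - ev y s).
  by rewrite -F_eq //; apply: latticeS; [case: Fs | case: Ft].
have D0 : (0 : R) < D%:R by rewrite ltr0n.
have p_gt0 : 0 < D%:R * (ev y t - ev y s) by rewrite mulr_gt0 // subr_gt0.
by have := norm_intr_ge1 yi; rewrite gt_eqF // gtr0_norm //; apply.
Qed.

(** A difference of slopes at a vertex is a determinant, at most [D ^ 2], divided by two heights,
    each at least [1 / D]. *)
Let K : R := D%:R ^+ 4.

Let slope_gap v a b : F v -> F a -> F b -> adjacent S v a -> adjacent S v b ->
  ev y v < ev y a -> ev y b < ev y v ->
  `|(ev x b - ev x v) / (ev y b - ev y v) - (ev x a - ev x v) / (ev y a - ev y v)|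
  <= K.
Proof.
move=> Fv Fa Fb va vb ya yb.
have ya0 : ev y a - ev y v != 0 by rewrite subr_eq0 gt_eqF.
have yb0 : ev y b - ev y v != 0 by rewrite subr_eq0 lt_eqF.
have -> : (ev x b - ev x v) / (ev y b - ev y v) -
    (ev x a - ev x v) / (ev y a - ev y v) =
    det v a b / ((ev y a - ev y v) * (ev y v - ev y b)).
  rewrite /det; field; rewrite ya0 yb0 /= subr_eq0 gt_eqF //.
have [->|W0] := eqVneq (det v a b) 0.
  by rewrite mul0r normr0 /K exprn_ge0.
have WD := det_corner Fv Fa Fb va vb W0.
have Ya := y_step Fv Fa ya; have Yb := y_step Fb Fv yb.
have p_gt0 : 0 < (ev y a - ev y v) * (ev y v - ev y b).
  by rewrite mulr_gt0 // subr_gt0.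
rewrite normrM normfV (gtr0_norm p_gt0) ler_pdivrMr //.
apply: le_trans WD _.
have -> : K * ((ev y a - ev y v) * (ev y v - ev y b)) = D%:R ^+ 2 *
  ((D%:R * (ev y a - ev y v)) * (D%:R * (ev y v - ev y b))) by rewrite /K; ring.
rewrite ler_peMr ?exprn_ge0 //.
by rewrite -[leLHS]mul1r ler_pM.
Qed.

(* The slopes [tau - j (K + 1)] are further apart than the slopes of the two
   edges at a vertex strictly between the base and the top, so distinct [j]
   are maximised at distinct such vertices, and there are at most [n]. *)
Let sweep (al : 'Hom(V, R^o)) (tau : R) :
  (forall v a b, F v -> F a -> F b -> adjacent S v a -> adjacent S v b ->
    ev y v < ev y a -> ev y b < ev y v ->
    (ev al b - ev al v) / (ev y b - ev y v) -
      (ev al a - ev al v) / (ev y a - ev y v) <= K) ->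
  (forall j : 'I_n.+1, exists2 s, F s & forall t, F t -> ev y t = ev y u0 ->
    ev al t - (tau - j.+1%:R * (K + 1)) * ev y t <
    ev al s - (tau - j.+1%:R * (K + 1)) * ev y s) ->
  exists (j : 'I_n.+1) t, [/\ F t, forall s, F s -> ev y s <= ev y t &
    forall s, F s -> ev al s - (tau - j.+1%:R * (K + 1)) * ev y s <=
                     ev al t - (tau - j.+1%:R * (K + 1)) * ev y t].
Proof.
move=> gap lower; set sl := fun j : 'I_n.+1 => tau - j.+1%:R * (K + 1).
pose Fs := [seq s <- S | ev nu s == ev nu u0].
have FsP s : s \in Fs <-> F s.
  by rewrite mem_filter; split=> [/andP[/eqP ? ?]//|[-> ->]]; rewrite eqxx.
have max j : exists t, F t /\ forall s, F s ->
    ev al s - sl j * ev y s <= ev al t - sl j * ev y t.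
  have u0F : u0 \in Fs by apply/FsP.
  have [t /FsP Ft tmin] := seq_argmin (fun s => - (ev al s - sl j * ev y s)) u0F.
  by exists t; split=> // s /FsP /tmin; rewrite lerN2.
have [t /all_and2[Ft tmax]] := choice max.
have [[j jtop]|notop] := pselect (exists j, forall s, F s -> ev y s <= ev y (t j)).
  by exists j, (t j); split=> // s; apply: tmax.
exfalso.
have mid j : ev y u0 < ev y (t j).
  rewrite lt_neqAle above_base // andbT; apply/eqP => yt.
  have [s Fs' /(_ _ (Ft j) (esym yt))] := lower j.
  by rewrite ltNge tmax.
have up j : exists a, [/\ F a, adjacent S (t j) a & ev y (t j) < ev y a].
  have [s Fs' ys] : exists2 s, F s & ev y (t j) < ev y s.
    apply: contrapT => h; apply: notop; exists j => s Fs'.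
    by rewrite leNgt; apply/negP => ys; apply: h; exists s.
  have [tS tF] := Ft j; have [sS sF] := Fs'.
  have [||||a [ta nua ya]] := @edge_in_face _ _ S nu (t j) (- y) s expS tS.
  - by rewrite tF.
  - exact: sS.
  - by rewrite sF tF.
  - by rewrite !evNf ltrN2.
  exists a; split=> //; last by move: ya; rewrite !evNf ltrN2.
  by split; [case: ta | rewrite nua].
have down j : exists b, [/\ F b, adjacent S (t j) b & ev y b < ev y (t j)].
  have [tS tF] := Ft j; have [u0S _] := inF0.
  have [||||b [tb nub yb]] := @edge_in_face _ _ S nu (t j) y u0 expS tS.
  - by rewrite tF.
  - exact: u0S.
  - by rewrite tF.
  - exact: mid.
  by exists b; split=> //; split; [case: tb | rewrite nub].
(* At a common maximiser for [i < j] the upward edge has slope at most [sl j] and the downward edge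
   slope at least [sl i], but [sl i - sl j] is at least [K + 1]. *)
have tinj : injective t.
  suff lt_inj (i j : 'I_n.+1) : (i < j)%N -> t i <> t j.
    move=> i j tij; apply: val_inj.
    by have [/lt_inj/(_ tij)|/lt_inj/(_ (esym tij))|] := ltngtP i j.
  move=> ij tij; have [a [Fa ta ya]] := up i; have [b [Fb tb yb]] := down i.
  have := gap _ _ _ (Ft i) Fa Fb ta tb ya yb.
  have Ha := tmax j _ Fa; rewrite -tij in Ha; have Hb := tmax i _ Fb.
  have A : (ev al a - ev al (t i)) / (ev y a - ev y (t i)) <= sl j.
    by rewrite ler_pdivrMr ?subr_gt0 //; lra.
  have B : sl i <= (ev al b - ev al (t i)) / (ev y b - ev y (t i)).
    by rewrite ler_ndivlMr ?subr_lt0 //; lra.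
  have : (i.+1%:R + 1 : R) <= j.+1%:R by rewrite natr1 ler_nat.
  have : 0 <= K by rewrite /K exprn_ge0.
  by rewrite /sl in A B; nra.
have ut : uniq [seq t j | j <- enum 'I_n.+1].
  by rewrite map_inj_uniq // enum_uniq.
have sub : {subset [seq t j | j <- enum 'I_n.+1] <= S}.
  by move=> s /mapP[j _ ->]; have [] := Ft j.
have := leq_trans (uniq_leq_size ut sub) sizeS.
by rewrite size_map size_enum_ord ltnn.
Qed.

Lemma two_face_bound :
  `|ev x (s1 - u1)| <= (D ^ 2 * (n + 2 * n.+1 * (D ^ 4 + 1)))%:R /\
  `|ev y (s1 - u1)| <= (D ^ 2 * (n + 2 * n.+1 * (D ^ 4 + 1)))%:R.
Proof.
have K_ge0 : 0 <= K by rewrite /K exprn_ge0.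
have jb (j : 'I_n.+1) : 1 <= (j.+1%:R : R) <= n.+1%:R.
  by rewrite ler1n ler_nat ltn_ord.
(* Right side: the slopes tried are all below [sigma], so [s1] beats every point of the base. *)
have [||j [tR [FR topR maxR]]] := @sweep x sigma.
- move=> v a b Fv Fa Fb va vb ya yb; apply: le_trans (slope_gap Fv Fa Fb va vb ya yb).
  exact: ler_norm.
- move=> j; exists s1 => // t Ft yt; rewrite yt.
  have := left_of_right_edge Ft; rewrite yt subrr mulr0 => xt.
  have := sigmaE; have := jb j => /andP[j1 _]; move: ys1.
  set q := ev y s1; set q0 := ev y u0 => q_gt.
  have : 0 < j.+1%:R * (K + 1) by rewrite mulr_gt0 //; lra.
  by set r := j.+1%:R * (K + 1) => r_gt0; nra.
(* Left side: the mirror image under [- x], starting from slope 0, with [s0] beating the base. *)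
have [||j' [tL [FL topL maxL]]] := @sweep (- x) 0.
- move=> v a b Fv Fa Fb va vb ya yb; apply: le_trans (slope_gap Fv Fa Fb va vb ya yb).
  rewrite !evNf -!opprD -[leRHS]normrN opprB.
  apply: le_trans (ler_norm _); rewrite !mulNr opprK addrC opprB.
  by rewrite le_eqVlt; apply/orP; left; apply/eqP; ring.
- move=> j'; exists s0 => // t Ft yt; rewrite yt ys0 !evNf xs0.
  have := right_of_left_edge Ft; have /andP[j1 _] := jb j'.
  have : 0 < j'.+1%:R * (K + 1) by rewrite mulr_gt0 //; lra.
  by set r := j'.+1%:R * (K + 1) => r_gt0; lra.
have HE : ev y tR = ev y tL by apply/le_anti; rewrite topL // topR.
have H1 : 1 <= ev y tL - ev y u0 by have := topL _ inFs0; rewrite ys0; lra.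
have width : ev x tR - ev x tL <= n%:R.
  have [le_RL|lt_LR] := leP (ev x tR) (ev x tL).
    by apply: (@le_trans _ _ 0); rewrite ?subr_le0 ?ler0n.
  have LR : tL != tR by apply: contraTneq lt_LR => ->; rewrite ltxx.
  have tE : tR - tL = (ev x tR - ev x tL) *: (u1 - u0).
    by rewrite (F_eq FR FL) HE subrr scale0r addr0.
  (* The top edge is a multiple of the lattice vector [u1 - u0], so its length in this unit is
     bounded by the count of lattice points. *)
  apply: ltW; apply: (lengthS _ _ tE); last first.
    by apply: latticeS; [case: inF0 | case: inF1].
  split=> //; [by case: FL | by case: FR |].
  have [|e e_gt0 eP] := @small_perturbation _ _ [seq s <- S | ev nu s != ev nu u0]
      (fun s => ev nu s - ev nu u0) (fun s => ev y tL - ev y s).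
    move=> s; rewrite mem_filter => /andP[ns sS].
    by rewrite subr_gt0 lt_neqAle eq_sym ns nuS.
  exists (nu - e *: y); rewrite !evDf !evNf !evZf HE FL.2 FR.2; split=> // s sS sL sR.
  rewrite !evDf !evNf !evZf; have [nus|nus] := eqVneq (ev nu s) (ev nu u0); last first.
    have := eP s; rewrite mem_filter nus sS => /(_ isT); lra.
  have Fs : F s by [].
  rewrite nus ltrD2l ltrN2 ltr_pM2l // lt_neqAle topL // andbT; apply/eqP => ys.
  have sE : s - tL = ((ev x s - ev x tL) / (ev x tR - ev x tL)) *: (tR - tL).
    rewrite tE scalerA divfK ?subr_eq0 ?gt_eqF // (F_eq Fs FL) ys subrr scale0r.
    by rewrite addr0.
  have [E|E] := exposed_collinear expS FL.1 FR.1 sS LR sE.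
    by rewrite E eqxx in sL.
  by rewrite E eqxx in sR.
have HR := maxR _ inF1; have HL := maxL _ inF0.
rewrite yu1 xu1 HE in HR; rewrite !evNf in HL.
(* At the height [h] of the top, the right side has moved by at least [(sigma - r) * h] and the left
   side by at most [r' * h]. The width there is at most [n] and [h] is at least 1, while [r] and
   [r'] are at most [n.+1 * (K + 1)]. *)
have sigma_le : sigma <= n%:R + 2 * n.+1%:R * (K + 1).
  have /andP[_ jn] := jb j; have /andP[_ jn'] := jb j'.
  set k := j.+1%:R in jn HR; set k' := j'.+1%:R in jn' HL.
  have e1 : k * (K + 1) <= n.+1%:R * (K + 1) by rewrite ler_wpM2r //; lra.
  have e2 : k' * (K + 1) <= n.+1%:R * (K + 1) by rewrite ler_wpM2r //; lra.
  set m := n.+1%:R * (K + 1) in e1 e2.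
  rewrite -mulrA -/m; set r := k * (K + 1) in HR e1; set r' := k' * (K + 1) in HL e2.
  have n0 : 0 <= (n%:R : R) by rewrite ler0n.
  set h := ev y tL - ev y u0 in H1.
  have HR' : 1 + (sigma - r) * h <= ev x tR - ev x u0 by rewrite /h; nra.
  have HL' : ev x tL - ev x u0 <= r' * h by rewrite /h; nra.
  have : (sigma - r - r') * h <= n%:R by nra.
  move=> HH; rewrite leNgt; apply/negP => lt_s; nra.
have adj10 := adjacent_sym adj01.
(* Up to sign, this corner determinant is the height of [s1] above the base, which is therefore at
   most [D ^ 2]. *)
have W : det u1 u0 s1 != 0.
  rewrite /det yu1 xu1 subrr mulr0 subr0 mulf_neq0 // subr_eq0.
    by rewrite lt_eqF ?ltrDl.
  by rewrite gt_eqF.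
have := det_corner inF1 inF0 inFs1 adj10 adj1 W.
have -> : det u1 u0 s1 = - (ev y s1 - ev y u1).
  by rewrite /det yu1 xu1 subrr; ring.
rewrite normrN -evB (gtr0_norm y_s1) => y_le.
have xE : ev x (s1 - u1) = sigma * ev y (s1 - u1) by rewrite !evB sigmaE yu1.
have D1 : 1 <= (D%:R : R) by rewrite ler1n.
have n0 : 0 <= (n%:R : R) by rewrite ler0n.
have m_ge : 1 <= n.+1%:R * (K + 1).
  by rewrite -[leLHS]mulr1 ler_pM // ?ler1n //; lra.
have BE : (D ^ 2 * (n + 2 * n.+1 * (D ^ 4 + 1)))%:R =
    D%:R ^+ 2 * (n%:R + 2 * n.+1%:R * (K + 1)) :> R.
  by rewrite natrM natrX natrD !natrM natrD natrX.
rewrite BE; set C := n%:R + _ in sigma_le *.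
have C1 : 1 <= C by rewrite /C -mulrA; lra.
rewrite xE normrM (gtr0_norm y_s1) mulrC; split.
  rewrite ler_pM ?normr_ge0 ?(ltW y_s1) // ler_norml sigma_le andbT.
  by apply: le_trans sigma_ge; rewrite lerN2.
by rewrite -[leLHS]mulr1 ler_pM ?(ltW y_s1).
Qed.

End TwoFace.

(** * Coordinates adapted to the normal cones *)

Lemma uniform_bound (T : finType) (Q : T -> nat -> Prop) :
  (forall t m m', (m <= m')%N -> Q t m -> Q t m') ->
  (forall t, exists m, Q t m) -> exists m, forall t, Q t m.
Proof.
move=> Qmono /choice[m mP]; exists (\max_t m t) => t.
by apply: Qmono (mP t); apply: leq_bigmax.
Qed.

Lemma nat_upper_bound (R : realType) (x : R) : exists m : nat, x <= m%:R.
Proof.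
have [x0|x0] := leP 0 x; last by exists 0; apply: ltW.
by exists (Num.bound x); apply/ltW/archi_boundP.
Qed.

Lemma fact_div_int (R : realType) (z : R) (N : nat) :
  z \is a Num.int -> z != 0 -> `|z| <= N%:R -> (N`!)%:R / z \is a Num.int.
Proof.
move=> zi z0; have /natrP[m mE] : `|z| \is a Num.nat by rewrite natr_norm_int.
rewrite mE ler_nat => mN.
have m_gt0 : (0 < m)%N by rewrite -(ltr_nat R) -mE normr_gt0.
have zE : z^-1 = Num.sg z / m%:R.
  rewrite -mE; have [z_lt|z_gt|z_eq] := ltgtP z 0; last by rewrite z_eq eqxx in z0.
    by rewrite ltr0_norm // ltr0_sg // mulN1r invrN opprK.
  by rewrite gtr0_norm // gtr0_sg // mul1r.
have /dvdnP[q ->] : (m %| N`!)%N by apply: dvdn_fact; rewrite m_gt0.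
have m0 : (m%:R : R) != 0 by rewrite pnatr_eq0 -lt0n.
rewrite zE natrM mulrAC -!mulrA mulVf // mulr1.
rewrite rpredM ?natr_int //.
case: (sgrP z) => _; [exact: rpred0 | exact: rpred1 | exact: rpredN1].
Qed.

Section Frames.
Context {R : realType} {V : vectType R} (M : set V) (n d : nat).

(** [edge_length] measures an edge by any lattice vector on its line, so no primitive vector has to
    be chosen; it is strict because both ends of an edge count as lattice points. *)
Record edge_bounded (S : seq V) : Prop := EdgeBounded {
  all_exposed : forall v, v \in S -> exposed S v;
  size_bound : (size S <= n)%N;
  lattice_diff : forall v w, v \in S -> w \in S -> M (w - v);
  edge_length : forall v w z (r : R),
    adjacent S v w -> M z -> w - v = r *: z -> r < n%:R;
  full_dim : forall f u, u \in S -> (forall s, s \in S -> ev f s = ev f u) -> f = 0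
}.

Definition combine (eta : 'I_d -> 'Hom(V, R^o)) (c : 'rV[R]_d) (w : V) : R :=
  \sum_k c 0 k * ev (eta k) w.

Record lattice_coordinates (eta : 'I_d -> 'Hom(V, R^o)) : Prop := LatticeCoordinates {
  coord_lattice : forall w, M w <-> forall k, ev (eta k) w \is a Num.int;
  coord_surj : forall x : 'I_d -> R, exists w, forall k, ev (eta k) w = x k;
  coord_inj : forall w, (forall k, ev (eta k) w = 0) -> w = 0
}.

(* Each row of [cs] lists the coefficients, with respect to [eta], of a
   generator of the normal cone at [v]. *)
Record frame (cs : seq 'rV[R]_d) (S : seq V) (v : V)
    (eta : 'I_d -> 'Hom(V, R^o)) : Prop := Frame {
  frame_coord :> lattice_coordinates eta;
  frame_ge0 : forall (j : 'I_(size cs)) s, s \in S -> 0 <= combine eta cs`_j (s - v);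
  frame_gen : forall nu, (forall s, s \in S -> ev nu v <= ev nu s) ->
    exists2 a : 'I_(size cs) -> R, forall j, 0 <= a j &
      forall w, ev nu w = \sum_j a j * combine eta cs`_j w
}.

(** If [z] were off the line, some [f] would vanish on the edge and not at [z]. Both [g + e *: f]
    and [g - e *: f] lie in the normal cone for small [e] and vanish on the edge, so they combine
    only generators vanishing there; hence both vanish at [z], and so does [f]. *)
Lemma facets_span_edge cs S v eta w z : frame cs S v eta -> adjacent S v w ->
  (forall j : 'I_(size cs), combine eta cs`_j (w - v) = 0 -> combine eta cs`_j z = 0) ->
  z \in <[w - v]>%VS.
Proof.
move=> fr [vS wS vw [g [gvw gS]]] zP; apply/negP => /negP zw.
have [f fw fz] := separate_from_subspace zw.
have {}fw : ev f w = ev f v.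
  by apply/eqP; rewrite -subr_eq0 -evB fw // memv_line.
have key e : (forall s, s \in S -> s != v -> s != w ->
    0 < (ev g s - ev g v) + e * (ev f s - ev f v)) -> ev g z + e * ev f z = 0.
  move=> eP; have [s sS|a a_ge0 aE] := frame_gen fr (nu := g + e *: f).
    rewrite !evDf !evZf.
    have [->//|sv] := eqVneq s v; have [->|sw] := eqVneq s w.
      by rewrite fw gvw.
    by have := eP s sS sv sw; lra.
  have := aE (w - v); rewrite evDf evZf !evB fw gvw !subrr mulr0 addr0.
  have ge0 j : true -> 0 <= a j * combine eta cs`_j (w - v).
    by move=> _; rewrite mulr_ge0 // (frame_ge0 fr).
  move=> /esym/(psumr_eq0P ge0) a0; rewrite -evZf -evDf aE big1 // => j _.
  have := a0 j isT => /eqP; rewrite mulf_eq0 => /orP[/eqP->|/eqP/zP->].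
    by rewrite mul0r.
  by rewrite mulr0.
pose s' := [seq s <- S | (s != v) && (s != w)].
have sP (b : V -> R) : exists2 e, 0 < e & forall s, s \in S -> s != v -> s != w ->
    0 < (ev g s - ev g v) + e * b s.
  have [|e e_gt0 eP] := @small_perturbation _ _ s' (fun s => ev g s - ev g v) b.
    by move=> s; rewrite mem_filter subr_gt0 => /andP[/andP[? ?] ?]; apply: gS.
  by exists e => // s sS sv sw; apply: eP; rewrite mem_filter sv sw.
have [e1 e1_gt0 /key k1] := sP (fun s => ev f s - ev f v).
have [e2 e2_gt0 P2] := sP (fun s => - (ev f s - ev f v)).
have k2 : ev g z + (- e2) * ev f z = 0.
  by apply: key => s sS sv sw; rewrite mulNr -mulrN P2.
by move: k1 k2; rewrite fz; lra.
Qed.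

(** The generators vanishing on an edge determine its coordinates up to a scalar. For each set of
    generators that occurs, one edge, possibly of another polytope, is fixed as a yardstick. *)
Lemma edge_coordinates_bounded (I : finType) (cs : I -> seq 'rV[R]_d) :
  exists B : nat, forall i S v w eta, edge_bounded S -> frame (cs i) S v eta ->
    adjacent S v w -> forall k, `|ev (eta k) (w - v)| <= B%:R.
Proof.
pose zeros i (eta : 'I_d -> 'Hom(V, R^o)) w :=
  [set j : 'I_(size (cs i)) | combine eta (cs i)`_j w == 0]%SET.
apply: uniform_bound => [i m m' mm' H S v w eta eS fr vw k|i].
  by apply: le_trans (H S v w eta eS fr vw k) _; rewrite ler_nat.
have [||B BP] := @uniform_bound {set 'I_(size (cs i))} (fun A B =>
    forall S v w eta, edge_bounded S -> frame (cs i) S v eta -> adjacent S v w ->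
    zeros i eta (w - v) = A -> forall k, `|ev (eta k) (w - v)| <= B%:R).
- move=> A m m' mm' H S v w eta eS fr vw zA k.
  by apply: le_trans (H S v w eta eS fr vw zA k) _; rewrite ler_nat.
- move=> A.
  have [[S0 [v0 [w0 [eta0 [eS0 fr0 vw0 zA0]]]]]|none] := pselect (exists S v w eta,
      [/\ edge_bounded S, frame (cs i) S v eta, adjacent S v w & zeros i eta (w - v) = A]);
    last first.
    by exists 0 => S v w eta eS fr vw zA; case: none; exists S, v, w, eta.
  have [m mP] : exists m : nat, forall k : 'I_d, `|ev (eta0 k) (w0 - v0)| <= m%:R.
    apply: uniform_bound => [k m m' mm' H|k]; last exact: nat_upper_bound.
    by apply: le_trans H _; rewrite ler_nat.
  (* The vector [z] copies the yardstick's coordinates into the present frame; it is a lattice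
     vector on the line of [w - v], so [w - v] is less than [n] times [z]. *)
  exists (n * m)%N => S v w eta eS fr vw zA k.
  have [z zE] := coord_surj fr (fun k => ev (eta0 k) (w0 - v0)).
  have combE c : combine eta c z = combine eta0 c (w0 - v0).
    by apply: eq_bigr => k' _; rewrite zE.
  have zin : z \in <[w - v]>%VS.
    apply: (facets_span_edge fr vw) => j j0; rewrite combE; apply/eqP.
    have : j \in zeros i eta0 (w0 - v0) by rewrite zA0 -zA inE j0.
    by rewrite inE.
  have z0 : z != 0.
    apply/eqP => z0; have [_ _ + _] := vw0; move=> /eqP; apply.
    apply/esym/eqP; rewrite -subr_eq0; apply/eqP/(coord_inj fr0) => k'.
    by rewrite -zE z0 ev0.
  have Mz : M z.
    apply/(coord_lattice fr) => k'; rewrite zE.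
    have [v0S w0S _ _] := vw0.
    exact: (coord_lattice fr0 (w0 - v0)).1 (lattice_diff eS0 v0S w0S) k'.
  have /vlineP[q zq] := zin.
  have q0 : q != 0 by apply: contraNneq z0 => q0; rewrite zq q0 scale0r.
  have wE : w - v = q^-1 *: z by rewrite zq scalerA mulVf // scale1r.
  have r_lt : q^-1 < n%:R := edge_length eS vw Mz wE.
  (* All generators are nonnegative at [z], hence so is the functional exposing [v], which is
     positive at [w - v]. *)
  have r_ge0 : 0 <= q^-1.
    have [vS wS nvw _] := vw; have [f fS] := all_exposed eS vS.
    have [s sS|a a_ge0 aE] := frame_gen fr (nu := f).
      by have [->//|sv] := eqVneq s v; rewrite ltW ?fS.
    have fw : 0 < ev f (w - v) by rewrite evB subr_gt0 fS // eq_sym.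
    rewrite leNgt; apply/negP => r_lt0; move: fw; rewrite wE evZ nmulr_rgt0 //.
    rewrite aE ltNge sumr_ge0 // => j _; rewrite combE mulr_ge0 //.
    by have [_ w0S _ _] := vw0; apply: (frame_ge0 fr0).
  rewrite wE evZ zE normrM ger0_norm // natrM ler_pM //.
  exact: ltW.
by exists B => S v w eta eS fr vw k; apply: BP eS fr vw erefl k.
Qed.

(** Cramer's rule: the denominator is a nonzero 2 by 2 minor [W] of integer coordinates bounded by
    [B], so it divides the factorial of [2 * (B * B)]. *)
Lemma corner_denominator (B : nat) cs S v eta a b (k l : R) :
  edge_bounded S -> frame cs S v eta ->
  (forall w, adjacent S v w -> forall k, `|ev (eta k) (w - v)| <= B%:R) ->
  adjacent S v a -> adjacent S v b -> b - v \notin <[a - v]>%VS ->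
  M (k *: (a - v) + l *: (b - v)) ->
  ((2 * (B * B))`!)%:R * k \is a Num.int /\ ((2 * (B * B))`!)%:R * l \is a Num.int.
Proof.
move=> eS fr bound va vb indep Mz.
set p := a - v in indep Mz *; set q := b - v in indep Mz *.
have intE w : adjacent S v w -> forall i, ev (eta i) (w - v) \is a Num.int.
  move=> [vS wS _ _]; apply/(coord_lattice fr); exact: (lattice_diff eS).
have pi := intE a va; have qi := intE b vb; have zi := (coord_lattice fr _).1 Mz.
rewrite -/p in pi; rewrite -/q in qi.
have [i [j W0]] : exists i j, ev (eta i) p * ev (eta j) q - ev (eta j) p * ev (eta i) q != 0.
  apply: contrapT => none.
  have {}none i j : ev (eta i) p * ev (eta j) q = ev (eta j) p * ev (eta i) q.
    apply/eqP; rewrite -subr_eq0; apply: contrapT => /negP h.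
    by apply: none; exists i, j.
  have [i pi0] : exists i, ev (eta i) p != 0.
    apply: contrapT => p0; have [_ _ + _] := va; move=> /eqP; apply.
    apply/esym/eqP; rewrite -subr_eq0; apply/eqP/(coord_inj fr) => i.
    by apply/eqP; apply: contrapT => /negP h; apply: p0; exists i.
  move: indep => /negP; apply; apply/vlineP.
  exists (ev (eta i) q / ev (eta i) p); apply/eqP; rewrite -subr_eq0.
  apply/eqP/(coord_inj fr) => j; rewrite evB evZ.
  by apply: (mulfI pi0); rewrite mulrBr none mulr0 mulrA mulrCA divff // mulr1 mulrC subrr.
set W := _ - _ in W0.
have Wi : W \is a Num.int by rewrite rpredB ?rpredM.
have pb := bound a va; have qb := bound b vb; rewrite -/p in pb; rewrite -/q in qb.
have WB : `|W| <= (2 * (B * B))%:R.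
  rewrite natrM mulr_natl mulr2n natrM; apply: le_trans (ler_normB _ _) _.
  by rewrite !normrM lerD // ler_pM.
have DW := fact_div_int Wi W0 WB.
clearbody p q.
have kE : k = (ev (eta i) (k *: p + l *: q) * ev (eta j) q -
    ev (eta j) (k *: p + l *: q) * ev (eta i) q) / W.
  by apply: (canRL (mulfK W0)); rewrite /W !evD !evZ; ring.
have lE : l = (ev (eta i) p * ev (eta j) (k *: p + l *: q) -
    ev (eta j) p * ev (eta i) (k *: p + l *: q)) / W.
  by apply: (canRL (mulfK W0)); rewrite /W !evD !evZ; ring.
by split; [rewrite kE | rewrite lE]; rewrite mulrCA rpredM // rpredB ?rpredM.
Qed.

(** Two-dimensional faces through an edge are exposed rays modulo its line; as [f] or its opposite
    is negative somewhere relative to the edge, it is negative on such a ray. *)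
Lemma exists_two_face S u0 u1 f : edge_bounded S -> adjacent S u0 u1 ->
  ev f u1 = ev f u0 -> f != 0 ->
  exists s0 s1 nu x y, [/\ adjacent S u0 s0, adjacent S u1 s1,
    (forall s, s \in S -> ev nu u0 <= ev nu s),
    [/\ ev nu u1 = ev nu u0, ev nu s0 = ev nu u0 & ev nu s1 = ev nu u0] &
    [/\ [/\ ev x (u1 - u0) = 1, ev x (s0 - u0) = 0, ev y (u1 - u0) = 0 & ev y (s0 - u0) = 1],
      forall s, s \in S -> ev nu s = ev nu u0 ->
        s - u0 = ev x (s - u0) *: (u1 - u0) + ev y (s - u0) *: (s0 - u0),
      0 < ev y (s1 - u1) & ev f (s1 - u1) != 0]].
Proof.
move=> eS adj01 f01 f0; have [u0S u1S nu01 [g [g01 gS]]] := adj01.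
have expS := all_exposed eS.
wlog [s sS fs] : f f01 f0 / exists2 s, s \in S & ev f s < ev f u0.
  move=> wl; have [s sS fs] : exists2 s, s \in S & ev f s != ev f u0.
    apply: contrapT => none; move: f0 => /eqP; apply; apply: (full_dim eS u0S) => s sS.
    by apply/eqP; apply: contrapT => /negP h; apply: none; exists s.
  have [fs'|fs'] := ltP (ev f s) (ev f u0).
    by apply: wl => //; exists s.
  have [||| s0 [s1 [nu [x [y [? ? ? ? [? ? ? nf]]]]]]] := wl (- f).
  - by rewrite !evNf f01.
  - by rewrite oppr_eq0.
  - by exists s => //; rewrite !evNf ltrN2 lt_neqAle eq_sym fs.
  exists s0, s1, nu, x, y; split=> //; split=> //.
  by rewrite -oppr_eq0 -evNf.
set e := u1 - u0; have ge : ev g e = 0 by rewrite evB g01 subrr.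
pose L := [seq s - u0 | s <- S].
have gL w : w \in L -> w \notin <[e]>%VS -> 0 < ev g w.
  move=> /mapP[t tS ->] tU; rewrite evB subr_gt0; apply: gS => //.
    by apply: contraNneq tU => ->; rewrite subrr mem0v.
  by apply: contraNneq tU => ->; rewrite memv_line.
have [|||w [nu [/mapP[k kS ->] kU fk nuU [nuk nuL nu0]]]] :=
    @exposed_ray _ _ L <[e]>%VS g f (s - u0) (vanishes_on_line ge) gL.
- by apply: vanishes_on_line; rewrite evB f01 subrr.
- exact: map_f.
- by rewrite evB subr_lt0.
set w0 := k - u0 in kU fk nuk nu0.
have gw : 0 < ev g w0 by apply: gL => //; apply: map_f.
have nuS t : t \in S -> ev nu u0 <= ev nu t.
  by move=> tS; rewrite -subr_ge0 -evB nuL //; apply: map_f.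
have nu1 : ev nu u1 = ev nu u0.
  by apply/eqP; rewrite -subr_eq0 -evB nuU // memv_line.
have nuk' : ev nu k = ev nu u0 by apply/eqP; rewrite -subr_eq0 -evB nuk.
have gk : ev g u0 < ev g k by rewrite -subr_gt0 -evB.
(* Since [g] is least exactly on the base, the second edge of the face at either end is one along
   which [g] increases. *)
have [||||s0 [adj0 nus0 gs0]] := @edge_in_face _ _ S nu u0 (- g) k expS u0S.
- exact: nuS.
- exact: kS.
- exact: nuk'.
- by rewrite !evNf ltrN2.
have [||||s1 [adj1 nus1 gs1]] := @edge_in_face _ _ S nu u1 (- g) k expS u1S.
- by move=> t tS; rewrite nu1 nuS.
- exact: kS.
- by rewrite nuk' nu1.
- by rewrite !evNf ltrN2 -g01.
rewrite !evNf ltrN2 in gs0; rewrite !evNf ltrN2 -g01 in gs1.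
set g0 := s0 - u0.
have gg0 : 0 < ev g g0 by rewrite evB subr_gt0.
have g0U : g0 \notin <[e]>%VS.
  by apply: contraTN gg0 => /vlineP[c ->]; rewrite evZ ge mulr0 ltxx.
have eU : e \notin <[g0]>%VS.
  apply/negP => /vlineP[c eE]; move: ge; rewrite eE evZ => /eqP.
  rewrite mulf_eq0 (gt_eqF gg0) orbF => /eqP c0; move: eE; rewrite c0 scale0r.
  by move=> /eqP; rewrite subr_eq0 eq_sym (negbTE nu01).
have [y yU y0] := separate_from_subspace g0U.
have [x xU x1] := separate_from_subspace eU.
have ye : ev y e = 0 by apply: yU; apply: memv_line.
have xg : ev x g0 = 0 by apply: xU; apply: memv_line.
have plane t : t \in S -> ev nu t = ev nu u0 ->
    exists a b, t - u0 = a *: e + b *: w0.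
  move=> tS nut; have : t - u0 \in (<[e]> + <[w0]>)%VS.
    by apply: nu0; [apply: map_f | rewrite evB nut subrr].
  by move=> /memv_addP[_ /vlineP[a ->] [_ /vlineP[b ->] ->]]; exists a, b.
have [s0S s1S] : s0 \in S /\ s1 \in S by case: adj0; case: adj1.
have [a [b g0E]] : exists a b, g0 = a *: e + b *: w0 := plane s0 s0S nus0.
have b_gt0 : 0 < b.
  by move: gg0; rewrite g0E evD !evZ ge mulr0 add0r pmulr_lgt0.
have change_basis (E G W : V) (p q p' q' : R) : q != 0 -> G = p *: E + q *: W ->
    p' *: E + q' *: W = (p' - q' / q * p) *: E + (q' / q) *: G.
  by move=> q0 ->; rewrite scalerDr !scalerA addrA -scalerDl subrK divfK.
have planeS t : t \in S -> ev nu t = ev nu u0 ->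
    t - u0 = ev x (t - u0) *: e + ev y (t - u0) *: g0.
  move=> tS nut; have [a' [b' tE]] := plane t tS nut.
  have b0 : b != 0 by rewrite gt_eqF.
  have tE' : t - u0 = (a' - b' / b * a) *: e + (b' / b) *: g0.
    by rewrite tE; apply: change_basis.
  by rewrite tE' !evD !evZ ye xg x1 y0 !mulr0 !mulr1 add0r addr0.
have [p [q s1E]] : exists p q, s1 - u1 = p *: e + q *: g0.
  exists (ev x (s1 - u0) - 1), (ev y (s1 - u0)).
  rewrite scalerBl scale1r addrAC -planeS ?nus1 ?nu1 //.
  by rewrite /e opprB addrA subrK.
have lin h : ev h (s1 - u1) = p * ev h e + q * ev h g0 by rewrite s1E evD !evZ.
have q_gt0 : 0 < q.
  have : 0 < ev g (s1 - u1) by rewrite evB -g01 subr_gt0.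
  by rewrite lin ge mulr0 add0r pmulr_lgt0.
exists s0, s1, nu, x, y; split=> //; first by rewrite nus1.
split=> //; first by rewrite lin ye y0 mulr0 add0r mulr1.
have fe : ev f e = 0 by rewrite evB f01 subrr.
have fg0 : ev f g0 = b * ev f w0 by rewrite g0E evD !evZ fe mulr0 add0r.
have fw0 : ev f w0 != 0 by rewrite lt_eqF.
by rewrite lin fe mulr0 add0r fg0 !mulf_neq0 // gt_eqF.
Qed.

End Frames.

(** * Bounded changes of coordinates and the walk over the vertices *)

Section Transitions.
Context {R : realType} {V : vectType R} (M : set V) (n d : nat).

(** The indices from 0 to [2 * B] encode the integers from [- B] to [B], which makes the bounded
    integer vectors a finite type. *)
Definition grid_coord (B : nat) (t : {ffun 'I_d -> 'I_(2 * B).+1}) (k : 'I_d) : R :=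
  (t k)%:R - B%:R.

Lemma grid_coordP (B : nat) (z : 'I_d -> R) :
  (forall k, z k \is a Num.int) -> (forall k, `|z k| <= B%:R) ->
  exists t, forall k, z k = grid_coord (B := B) t k.
Proof.
move=> zi zB.
have /choice[t tE] k : exists m : 'I_(2 * B).+1, z k = m%:R - B%:R.
  have := zB k; rewrite ler_norml => /andP[z1 z2].
  have : z k + B%:R \is a Num.nat by rewrite natrEint rpredD ?natr_int //=; lra.
  move=> /natrP[m mE]; have mB : (m < (2 * B).+1)%N.
    by rewrite ltnS -(ler_nat R) -mE natrM; lra.
  by exists (Ordinal mB); rewrite -mE addrK.
by exists [ffun k => t k] => k; rewrite /grid_coord ffunE.
Qed.

(** The coefficients that write the unit vectors in terms of a spanning set [A] of grid vectors
    depend on [A] alone, not on the frames. Spanning is stated dually, in the form that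
    two-dimensional faces provide. *)
Lemma spanning_set_bound (B : nat) : exists C : nat,
  forall (A : {set {ffun 'I_d -> 'I_(2 * B).+1}}) (eta eta' : 'I_d -> 'Hom(V, R^o)) (b' : R),
    (forall x : 'I_d -> R, exists w, forall k, ev (eta k) w = x k) ->
    (forall w, (forall k, ev (eta k) w = 0) -> w = 0) -> 0 <= b' ->
    (forall t, t \in A -> exists2 g, forall k, ev (eta k) g = grid_coord t k &
       forall k, `|ev (eta' k) g| <= b') ->
    (forall f, (forall t g, t \in A -> (forall k, ev (eta k) g = grid_coord t k) ->
       ev f g = 0) -> f = 0) ->
    forall w (b : R), (forall k, `|ev (eta k) w| <= b) ->
    forall k, `|ev (eta' k) w| <= C%:R * b' * b.
Proof.
apply: uniform_bound => [A m m' mm' H eta eta' b' surj inj b0 bA span w b wb k|A].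
  apply: le_trans (H eta eta' b' surj inj b0 bA span w b wb k) _.
  rewrite ler_wpM2r ?ler_wpM2r ?ler_nat //.
  exact: le_trans (normr_ge0 _) (wb k).
have [[c cE]|none] := pselect (exists c : 'I_d -> {ffun 'I_d -> 'I_(2 * B).+1} -> R,
    forall k l, \sum_(t in A) c k t * grid_coord t l = (k == l)%:R); last first.
  exists 0 => eta eta' b' surj inj b0 bA span; case: none.
  have [g gE] := choice (fun t => surj (grid_coord (B := B) t)).
  have [U_full|] := eqVneq (\sum_(t in A) <[g t]>)%VS fullv.
    have wP k : exists c : {ffun 'I_d -> 'I_(2 * B).+1} -> R,
        forall l, \sum_(t in A) c t * grid_coord t l = (k == l)%:R.
      have [w wE] := surj (fun l => (k == l)%:R).
      have : w \in (\sum_(t in A) <[g t]>)%VS by rewrite U_full memvf.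
      move=> /memv_sumP[vs vsP wsum].
      have /choice[c cE] t : exists a : R, t \in A -> vs t = a *: g t.
        have [tA|] := boolP (t \in A); last by exists 0.
        by have /vlineP[a aE] := vsP t tA; exists a.
      exists c => l; rewrite -wE wsum ev_sum; apply: eq_bigr => t tA.
      by rewrite cE // evZ gE.
    by have [c cP] := choice wP; exists c.
  move=> U_proper.
  have [z zU] : exists z, z \notin (\sum_(t in A) <[g t]>)%VS.
    apply: contrapT => all; move: U_proper => /eqP; apply; apply/eqP.
    rewrite eqEsubv subvf /=; apply/subvP => z _; apply: contrapT => /negP zU.
    by apply: all; exists z.
  have [f fU fz] := separate_from_subspace zU.
  suff f0 : f = 0 by move: fz; rewrite f0 ev0f => /esym/eqP; rewrite oner_eq0.
  apply: span => t g' tA g'E; apply: fU.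
  have -> : g' = g t.
    by apply/eqP; rewrite -subr_eq0; apply/eqP/inj => k; rewrite evB g'E gE subrr.
  by apply: (subvP (sumv_sup t _ (subvv _))) (memv_line _).
have [C CP] := nat_upper_bound (\sum_k \sum_(t in A) `|c k t|).
exists C => eta eta' b' surj inj b'_ge0 bA span w b wb k.
have /choice[g gP] t : exists g, t \in A ->
    (forall k, ev (eta k) g = grid_coord t k) /\ forall k, `|ev (eta' k) g| <= b'.
  have [tA|] := boolP (t \in A); last by exists 0.
  by have [g ? ?] := bA t tA; exists g.
have b_ge0 : 0 <= b := le_trans (normr_ge0 _) (wb k).
have hE l k' : ev (eta l) (\sum_(t in A) c k' t *: g t) = (k' == l)%:R.
  by rewrite ev_sum -cE; apply: eq_bigr => t tA; rewrite evZ (gP t tA).1.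
have wE : w = \sum_k' ev (eta k') w *: \sum_(t in A) c k' t *: g t.
  apply/eqP; rewrite -subr_eq0; apply/eqP/inj => l; rewrite evB ev_sum.
  under eq_bigr do rewrite evZ hE.
  rewrite (bigD1 l) //= eqxx mulr1 [X in _ - (_ + X)]big1 ?addr0 ?subrr // => k' /negbTE ->.
  by rewrite mulr0.
rewrite wE ev_sum; apply: le_trans (ler_norm_sum _ _ _) _.
apply: (@le_trans _ _ ((\sum_k \sum_(t in A) `|c k t|) * b' * b)); last first.
  by rewrite ler_wpM2r // ler_wpM2r.
rewrite !mulr_suml; apply: ler_sum => i _; rewrite evZ normrM mulrC.
rewrite ler_pM //; rewrite ev_sum; apply: le_trans (ler_norm_sum _ _ _) _.
rewrite mulr_suml; apply: ler_sum => t tA; rewrite evZ normrM.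
by rewrite ler_wpM2l // (gP t tA).2.
Qed.

Context (I : finType) (cs : I -> seq 'rV[R]_d).

Definition framed (S : seq V) := edge_bounded M n S /\
  forall v, v \in S -> exists i eta, frame M (cs i) S v eta.

(* Two adjacent normal cones share only a facet, which determines the change of
   coordinates up to a shear; the two-dimensional faces through the edge bound
   the shear. *)
Lemma transition_bounded : exists C : nat, forall i j S u v eta_u eta_v,
  framed S -> frame M (cs i) S u eta_u -> frame M (cs j) S v eta_v -> adjacent S u v ->
  forall w (b : R), (forall k, `|ev (eta_v k) w| <= b) ->
  forall k, `|ev (eta_u k) w| <= C%:R * b.
Proof.
have [B BP] := edge_coordinates_bounded M n cs.
pose D := (2 * (B * B))`!; pose B2 := (D ^ 2 * (n + 2 * n.+1 * (D ^ 4 + 1)))%N.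
have B2_gt0 : (0 < B2)%N.
  by rewrite /B2 muln_gt0 expn_gt0 fact_gt0 /= addn_gt0 muln_gt0 addn1 orbT.
have [C CP] := spanning_set_bound B.
(* In the face, an edge at [v] is [p *: (v - u) + q *: (s0 - u)] with [p], [q] bounded by [B2], and
   the edges at [u] have coordinates at most [B]. *)
pose b' : R := (2 * B2 * B)%:R.
exists (C * (2 * B2 * B))%N => i j S u v eta_u eta_v [eS frS] fru frv uv.
have vu := adjacent_sym uv; have [uS vS _ _] := uv.
have Bb : (B%:R : R) <= b'.
  by rewrite /b' ler_nat leq_pmull // muln_gt0.
pose A := [set t | `[< exists s, [/\ adjacent S v s,
  forall k, ev (eta_v k) (s - v) = grid_coord (B := B) t k &
  forall k, `|ev (eta_u k) (s - v)| <= b'] >]]%SET.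
have memA s : adjacent S v s -> (forall k, `|ev (eta_u k) (s - v)| <= b') ->
    exists2 t, t \in A & forall k, ev (eta_v k) (s - v) = grid_coord (B := B) t k.
  move=> vs sb; have [k|t tE] := grid_coordP (B := B) _ (BP _ _ _ _ _ eS frv vs).
    have [_ sS _ _] := vs.
    exact: (coord_lattice frv _).1 (lattice_diff eS vS sS) k.
  by exists t => //; rewrite inE; apply/asboolP; exists s.
move=> w b wb k; rewrite natrM.
apply: (CP A eta_v eta_u b' (coord_surj frv) (coord_inj frv)) wb k => [|t|f fA].
- exact: ler0n.
- by rewrite inE => /asboolP[s [_ ? ?]]; exists (s - v).
(* The edge from [v] to [u] is represented in [A], so [f] is constant on it. If [f] were nonzero,
   the second edge at [v] of some face would also be represented in [A], yet [f] would not vanish on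
   it. *)
apply: contrapT => /eqP f0.
have fu : ev f v = ev f u.
  have [k|t tA tE] := memA u vu.
    rewrite -opprB evN normrN; apply: le_trans Bb.
    exact: BP eS fru uv k.
  by apply/esym/eqP; rewrite -subr_eq0 -evB; apply/eqP; apply: fA tA tE.
have [s0 [s1 [nu [x [y [us0 vs1 nuS [nu1 nus0 nus1]
  [[x1 x0 y1 y0] plane ys1 fs1]]]]]]] := exists_two_face eS uv fu f0.
have corner s a c (p q : R) : adjacent S s a -> adjacent S s c ->
    c - s \notin <[a - s]>%VS -> M (p *: (a - s) + q *: (c - s)) ->
    D%:R * p \is a Num.int /\ D%:R * q \is a Num.int.
  move=> sa sc; have [sS _ _ _] := sa; have [i' [eta fr]] := frS s sS.
  by apply: (corner_denominator eS fr _ sa sc) => w' sw'; apply: BP eS fr sw'.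
have [xb yb] := two_face_bound (all_exposed eS) (size_bound eS) (lattice_diff eS)
  (edge_length eS) (fact_gt0 _) corner uv us0 vs1 nuS nu1 nus0 nus1 x1 x0 y1 y0 plane ys1.
have s1E : s1 - v = ev x (s1 - v) *: (v - u) + ev y (s1 - v) *: (s0 - u).
  have [_ s1S _ _] := vs1.
  have -> : s1 - v = (s1 - u) - (v - u) by rewrite opprB addrA subrK.
  by rewrite {1}(plane s1 s1S nus1) !(evB _ _ (v - u)) x1 y1 subr0 scalerBl scale1r addrAC.
move: (ev x (s1 - v)) (ev y (s1 - v)) xb yb s1E => p q xb yb s1E.
have [l|t tA tE] := memA s1 vs1; last by move/eqP: fs1; apply; apply: fA tA tE.
rewrite s1E evD !evZ; apply: le_trans (ler_normD _ _) _; rewrite !normrM /b'.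
rewrite -mulnA natrM mulr_natl mulr2n natrM.
by rewrite lerD // ler_pM //; apply: BP eS fru _ l.
Qed.

(** A functional [f] exposing [v0] guides the walk: from any other vertex an edge descends. The
    induction is on the number of vertices below, and each edge, bounded by [B] in its own frame, is
    carried back through the transitions passed so far. *)
Lemma vertices_bounded : exists C : nat, forall i S v0 eta, framed S ->
  frame M (cs i) S v0 eta -> v0 \in S ->
  forall v, v \in S -> forall k, `|ev (eta k) (v - v0)| <= C%:R.
Proof.
have [B BP] := edge_coordinates_bounded M n cs.
(* The successor makes [C] at least 1, so that its powers increase. *)
have [C0 CP] := transition_bounded; pose C := C0.+1.
exists (n * C ^ n * B)%N => i0 S v0 eta0 fS fr0 v0S v vS.
have [eS frS] := fS.
have [f fv0] := all_exposed eS v0S.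
suff main m w : w \in S -> (size [seq s <- S | (ev f s < ev f w)%R] <= m)%N ->
    exists i eta, [/\ frame M (cs i) S w eta,
      forall z (b : R), 0 <= b -> (forall k, `|ev (eta k) z| <= b) ->
        forall k, `|ev (eta0 k) z| <= (C ^ m)%:R * b &
      forall k, `|ev (eta0 k) (w - v0)| <= (m * C ^ m * B)%:R].
  have sz : (size [seq s <- S | (ev f s < ev f v)%R] <= n)%N.
    by apply: leq_trans (size_bound eS); rewrite size_filter count_size.
  by have [i [eta [_ _]]] := main n v vS sz.
elim: m w => [|m IHm] w wS szw; have [->|wv0] := eqVneq w v0.
- exists i0, eta0; split=> // [z b b0 zb k|k]; first by rewrite mul1r.
  by rewrite subrr ev0 normr0.
- have : v0 \in [seq s <- S | (ev f s < ev f w)%R] by rewrite mem_filter v0S fv0.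
  by move: szw; rewrite leqn0 size_eq0 => /eqP ->.
- exists i0, eta0; split=> // [z b b0 zb k|k]; last by rewrite subrr ev0 normr0.
  by apply: le_trans (zb k) _; rewrite ler_peMl // ler1n expn_gt0.
have [||||w' [ww' _ fw']] := @edge_in_face _ _ S 0 w f v0 (all_exposed eS) wS.
- by move=> s _; rewrite !ev0f.
- exact: v0S.
- by rewrite !ev0f.
- exact: fv0.
have [_ w'S _ _] := ww'; have w'w := adjacent_sym ww'.
have szw' : (size [seq s <- S | (ev f s < ev f w')%R] <= m)%N.
  rewrite -ltnS; apply: leq_trans szw.
  have -> : [seq s <- S | (ev f s < ev f w')%R] =
      [seq s <- [seq s <- S | (ev f s < ev f w)%R] | (ev f s < ev f w')%R].
    rewrite -filter_predI; apply: eq_filter => s /=.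
    by case: ltP => // h; rewrite (lt_trans h fw').
  rewrite size_filter ltn_neqAle count_size andbT -all_count.
  by apply/allPn; exists w'; rewrite ?ltxx // mem_filter fw'.
have [i' [eta' [fr' tr' pos']]] := IHm w' w'S szw'.
have [i [eta fr]] := frS w wS.
exists i, eta; split=> // [z b b0 zb k|k].
  have zb' l : `|ev (eta' l) z| <= C%:R * b.
    apply: le_trans (CP _ _ _ _ _ _ _ fS fr' fr w'w z b zb l) _.
    by rewrite ler_wpM2r // ler_nat.
  by rewrite expnSr natrM -mulrA; apply: tr' => //; rewrite mulr_ge0.
have -> : w - v0 = (w' - v0) + (w - w') by rewrite [RHS]addrC addrA subrK.
rewrite evD; apply: le_trans (ler_normD _ _) _.
have := tr' (w - w') B%:R (ler0n _ _) (BP _ _ _ _ _ eS fr' w'w) k.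
have := pos' k; rewrite -natrM => h1 h2; apply: le_trans (lerD h1 h2) _.
rewrite -natrD ler_nat -mulnDl -mulSnr leq_mul //.
by rewrite leq_mul // leq_pexp2l.
Qed.

End Transitions.

(** * Lattice bases and the frames given by cone equivalences *)

Section Lattices.
Context {R : realType}.

Lemma lattice_has_coordinates (V : vectType R) (M : set V) d :
  is_lattice M -> \dim {:V} = d -> exists eta : 'I_d -> 'Hom(V, R^o),
    lattice_coordinates M eta.
Proof.
move=> [X [Xb ->]] <-{d}; have Xfree := basis_free Xb.
have /choice[eta etaE] (k : 'I_(\dim {:V})) :
    exists f : 'Hom(V, R^o), forall v, ev f v = coord X k v.
  pose c : V -> R^o := coord X k.
  have clin : linear c by move=> a x y; rewrite /c linearP.
  pose cL : {linear V -> R^o} := HB.pack c (GRing.isLinear.Build _ _ _ _ c clin).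
  by exists (linfun cL) => v; rewrite /ev lfunE.
have expand v : v = \sum_k ev (eta k) v *: X`_k.
  under eq_bigr do rewrite etaE.
  exact: coord_basis Xb (memvf v).
exists eta; split.
- move=> w; split=> [[a ->] k|wi].
    rewrite ev_sum (bigD1 k) //= big1 => [|i ik].
      by rewrite -scaler_int evZ etaE coord_free // eqxx mulr1 addr0 intr_int.
    by rewrite -scaler_int evZ etaE coord_free // (negbTE ik) mulr0.
  have /choice[a aE] k : exists z : int, ev (eta k) w = z%:~R.
    by have /intrP[z zE] := wi k; exists z.
  exists [ffun k => a k]; rewrite {1}(expand w); apply: eq_bigr => k _.
  by rewrite ffunE aE scaler_int.
- move=> x; exists (\sum_k x k *: X`_k) => k.
  by rewrite etaE coord_sum_free.
- move=> w w0; rewrite (expand w) big1 // => k _.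
  by rewrite w0 scale0r.
Qed.

Lemma dual_basis (V : vectType R) (M : set V) d (eta : 'I_d -> 'Hom(V, R^o)) :
  lattice_coordinates M eta -> exists2 e : 'I_d -> V,
    forall k l, ev (eta l) (e k) = (k == l)%:R &
    forall w, w = \sum_k ev (eta k) w *: e k.
Proof.
move=> co; have [e eE] := choice (fun k => coord_surj co (fun l => (k == l)%:R)).
exists e => // w; apply/eqP; rewrite -subr_eq0; apply/eqP/(coord_inj co) => l.
rewrite evB ev_sum (bigD1 l) //= evZ eE eqxx mulr1.
rewrite [X in _ - (_ + X)]big1 ?addr0 ?subrr // => k kl.
by rewrite evZ eE (negbTE kl) mulr0.
Qed.

Lemma lattice_sub (V : vectType R) (M : set V) d (eta : 'I_d -> 'Hom(V, R^o)) v w :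
  lattice_coordinates M eta -> M v -> M w -> M (w - v).
Proof.
move=> co /(coord_lattice co) vi /(coord_lattice co) wi.
by apply/(coord_lattice co) => k; rewrite evB rpredB.
Qed.

Lemma lattice_addMn (V : vectType R) (M : set V) d (eta : 'I_d -> 'Hom(V, R^o)) v z m :
  lattice_coordinates M eta -> M v -> M z -> M (v + z *+ m).
Proof.
move=> co /(coord_lattice co) vi /(coord_lattice co) zi.
apply/(coord_lattice co) => k; rewrite evD -scaler_nat evZ rpredD // rpredM //.
by rewrite natr_int.
Qed.

Definition frame_of_cone (W : vectType R) d (L C : set W) (cs : seq 'rV[R]_d) :=
  forall (V : vectType R) (M : set V) (S : seq V) (v : V), is_lattice M ->
    \dim {:V} = d -> v \in S -> uniq S ->
    cone_equivalent (dual_lattice M) (normal_cone (conv_hull S) v) L C ->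
    exists eta, frame M cs S v eta.

(** The rows are the generators of [C] in a basis of [L], so they depend on the cone only; the frame
    at a vertex is the pullback of that basis along the equivalence. *)
Lemma lattice_cone_frame (W : vectType R) d (L C : set W) :
  lattice_cone d L C -> exists cs, frame_of_cone (d := d) L C cs.
Proof.
move=> [dimW latL _ _ [s [sL CE]]].
have [zeta coL] := lattice_has_coordinates latL dimW.
have [y yE yexp] := dual_basis coL.
exists [seq \row_k ev (zeta k) c | c <- s] => V M S v latM dimV vS uS [phi [bij phiN phiC]].
have [eta0 coM] := lattice_has_coordinates latM dimV.
have [e eE eexp] := dual_basis coM.
have phi_inj : injective phi := bij_inj bij.
have /choice[eta etaE] k : exists f, phi f = y k.
  by have [g _ gK] := bij; exists (g (y k)); rewrite gK.
have expand nu w : ev nu w = \sum_k ev (zeta k) (phi nu) * ev (eta k) w.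
  have -> : nu = \sum_k ev (zeta k) (phi nu) *: eta k.
    apply: phi_inj; rewrite linear_sum {1}(yexp (phi nu)).
    by apply: eq_bigr => k _; rewrite linearZ /= etaE.
  rewrite ev_sumf linear_sum; apply: eq_bigr => k _; rewrite evZf.
  congr (_ * _); rewrite ev_sum (bigD1 k) //= big1 => [|l lk].
    by rewrite linearZ /= evZ etaE yE eqxx mulr1 addr0.
  by rewrite linearZ /= evZ etaE yE (negbTE lk) mulr0.
have combE c w nu : phi nu = c -> combine eta (\row_k ev (zeta k) c) w = ev nu w.
  by move=> <-; rewrite expand; apply: eq_bigr => k _; rewrite mxE.
have coE : lattice_coordinates M eta.
  split.
  - move=> w; split=> [Mw k|wi].
      have [nu nuN nuE] : (phi @` dual_lattice M) (y k).
        rewrite phiN; apply/(coord_lattice coL) => l; rewrite yE natr_int //.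
      have <- : nu = eta k by apply: phi_inj; rewrite nuE etaE.
      exact: nuN.
    apply/(coord_lattice coM) => l; rewrite expand rpred_sum // => k _.
    rewrite rpredM //; apply: (coord_lattice coL _).1; rewrite -phiN.
    exists (eta0 l) => // x Mx; exact: (coord_lattice coM x).1.
  - move=> x.
    (* The matrices [ev (eta j) (e l)] and [ev (zeta k) (phi (eta0 l))] are inverse to each other up
       to transposition, which solves the linear system. *)
    exists (\sum_l (\sum_k ev (zeta k) (phi (eta0 l)) * x k) *: e l) => j.
    rewrite ev_sum.
    have etaj : eta j = \sum_l ev (eta j) (e l) *: eta0 l.
      apply/lfunP => w; rewrite -[LHS]/(ev (eta j) w) -[RHS]/(ev _ w) ev_sumf.
      rewrite {1}(eexp w) ev_sum; apply: eq_bigr => l _.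
      by rewrite evZ evZf mulrC.
    have delta k : \sum_l ev (eta j) (e l) * ev (zeta k) (phi (eta0 l)) = (j == k)%:R.
      rewrite -yE -etaE {2}etaj linear_sum ev_sum; apply: eq_bigr => l _.
      by rewrite linearZ /= evZ.
    under eq_bigr do rewrite evZ mulr_suml.
    rewrite exchange_big /= (bigD1 j) //= [X in _ + X]big1 => [|k kj].
      under eq_bigr do rewrite mulrAC [_ * ev (eta j) _]mulrC.
      by rewrite -mulr_suml delta eqxx mul1r addr0.
    under eq_bigr do rewrite mulrAC [_ * ev (eta j) _]mulrC.
    by rewrite -mulr_suml delta eq_sym (negbTE kj) mul0r.
  - move=> w w0; apply: (coord_inj coM) => l; rewrite expand big1 // => k _.
    by rewrite w0 mulr0.
exists eta; split=> // [j t tS|nu nuS].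
  have js : (j < size s)%N by apply: leq_trans (ltn_ord j) _; rewrite size_map.
  rewrite (nth_map 0) //.
  have : C s`_j.
    rewrite CE; exists (fun i => (i == Ordinal js)%:R); split=> [i|].
      by rewrite ler0n.
    rewrite (bigD1 (Ordinal js)) //= eqxx scale1r big1 ?addr0 // => i /negbTE ->.
    by rewrite scale0r.
  rewrite -phiC => -[nu nuP nuE]; rewrite (combE _ _ _ nuE).
  by apply: nuP; apply/conv_hullP; rewrite undup_id //; apply: hull_mem.
have : C (phi nu).
  rewrite -phiC; exists nu => // t /conv_hullP; rewrite undup_id // => -[c [c0 c1 ->]].
  rewrite -[X in _ <= X]/(ev nu _) evB subr_ge0 ev_sum -[leLHS]mul1r -c1 mulr_suml.
  rewrite big_seq [leRHS]big_seq; apply: ler_sum => t' t'S.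
  by rewrite evZ ler_wpM2l // nuS.
rewrite CE => -[a [a0 aE]].
have sz : size [seq \row_k ev (zeta k) c | c <- s] = size s by rewrite size_map.
exists (fun j => a (cast_ord sz j)) => // w.
have /choice[nus nusE] (j : 'I_(size s)) : exists f, phi f = s`_j.
  by have [g _ gK] := bij; exists (g s`_j); rewrite gK.
have -> : nu = \sum_j a j *: nus j.
  by apply: phi_inj; rewrite aE linear_sum; apply: eq_bigr => j _; rewrite linearZ /= nusE.
rewrite ev_sumf (reindex (cast_ord sz)) /=; last first.
  by exists (cast_ord (esym sz)) => i _; rewrite ?cast_ordK ?cast_ordKV.
apply: eq_bigr => j _; rewrite evZf (nth_map 0); last first.
  by apply: leq_trans (ltn_ord j) _; rewrite size_map.
by rewrite (combE _ _ _ (nusE (cast_ord sz j))).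
Qed.

End Lattices.

(** * Lattice polytopes *)

Lemma card_le_witness (T : Type) (A : set T) (n m : nat) (g : nat -> T) :
  (A #<= `I_n)%card -> (forall i, (i < m)%N -> A (g i)) ->
  (forall i j, (i < m)%N -> (j < m)%N -> g i = g j -> i = j) -> (m <= n)%N.
Proof.
move=> An Ag ginj; rewrite -card_le_II; apply: card_le_trans An.
apply: (@card_le_trans _ _ _ (g @` `I_m)).
  have gI : {in `I_m &, injective g}.
    by move=> i j; rewrite !inE; apply: ginj.
  by have := inj_card_eq gI; rewrite card_eq_le => /andP[].
by apply: subset_card_le => _ [i im <-]; apply: Ag.
Qed.

Section Polytopes.
Context {R : realType} {V : vectType R}.
Implicit Types (S : seq V) (P : set V).

Lemma hull_segment S v w (t : R) : uniq S -> v \in S -> w \in S ->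
  0 <= t -> t <= 1 -> hull S (v + t *: (w - v)).
Proof.
move=> uS vS wS t0 t1.
have [a [a0 a1 aE]] := hull_mem uS vS; have [b [b0 b1 bE]] := hull_mem uS wS.
exists (fun u => (1 - t) * a u + t * b u); split.
- by move=> u; rewrite addr_ge0 // mulr_ge0 // subr_ge0.
- by rewrite big_split /= -!mulr_sumr a1 b1 !mulr1 subrK.
- under eq_bigr do rewrite scalerDl -!scalerA.
  rewrite big_split /= -!scaler_sumr -aE -bE scalerBl scale1r scalerBr.
  by rewrite addrA addrAC.
Qed.

Lemma hull_min S f v x : (forall s, s \in S -> ev f v <= ev f s) -> hull S x ->
  ev f v <= ev f x.
Proof.
move=> fS [c [c0 c1 ->]]; rewrite ev_sum -[leLHS]mul1r -c1 mulr_suml.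
rewrite big_seq [leRHS]big_seq; apply: ler_sum => s sS.
by rewrite evZ ler_wpM2l // fS.
Qed.

Lemma hull_min_face S f v x (U : {vspace V}) :
  (forall s, s \in S -> ev f v <= ev f s) ->
  (forall s, s \in S -> ev f s = ev f v -> s - v \in U) ->
  hull S x -> ev f x = ev f v -> x - v \in U.
Proof.
move=> fS fU [c [c0 c1 ->]] fx.
have sumE : \sum_(s <- S) c s * (ev f s - ev f v) = 0.
  under eq_bigr do rewrite mulrBr -evZ.
  by rewrite sumrB -ev_sum fx -mulr_suml c1 mul1r subrr.
have c_eq0 s : s \in S -> c s * (ev f s - ev f v) = 0.
  move=> sS; apply/eqP; move/eqP: sumE; rewrite big_seq psumr_eq0 => [/allP|t tS].
    by move=> /(_ s sS); rewrite sS.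
  by rewrite mulr_ge0 // subr_ge0 fS.
rewrite -[v in _ - v]scale1r -c1 scaler_suml -sumrB big_seq.
apply: rpred_sum => s sS; rewrite -scalerBr.
have := c_eq0 s sS => /eqP; rewrite mulf_eq0 subr_eq0 => /orP[/eqP->|/eqP fs].
  by rewrite scale0r mem0v.
by rewrite memvZ // fU.
Qed.

Lemma has_dim_full (A : set V) d : \dim {:V} = d -> has_dim A d <-> aff_hull A = setT.
Proof.
move=> dV; split=> [[x [U [dU ->]]]|AT].
  apply/seteqP; split=> // z _; exists (z - x); last by rewrite addrC subrK.
  have /eqP-> : U == fullv by rewrite eqEdim subvf dU dV leqnn.
  exact: memvf.
exists 0, fullv; split=> //; rewrite AT; apply/seteqP; split=> // z _.
by exists z; [apply: memvf | rewrite add0r].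
Qed.

Lemma has_dim_line (A : set V) v w : A v -> A w -> v != w ->
  (forall x, A x -> x - v \in <[w - v]>%VS) -> has_dim A 1.
Proof.
move=> Av Aw vw AU; exists v, <[w - v]>%VS; split.
  by rewrite dim_vline subr_eq0 eq_sym vw.
apply/seteqP; split=> [x [k [y [c [Ay c1 ->]]]]|_ [_ /vlineP[t ->] <-]].
  exists (\sum_i c i *: y i - v); last by rewrite addrC subrK.
  rewrite /= -[v in _ - v]scale1r -c1 scaler_suml -sumrB.
  by apply: rpred_sum => i _; rewrite -scalerBr memvZ // AU.
exists 2, (fun i => if i == ord0 then v else w), (fun i => if i == ord0 then 1 - t else t).
split.
- by move=> i; case: ifP.
- by rewrite !big_ord_recl big_ord0 /= addr0 subrK.
- rewrite !big_ord_recl big_ord0 /= addr0 scalerBl scale1r scalerBr.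
  by rewrite addrA addrAC.
Qed.

Lemma adjacent_edge S v w : uniq S -> adjacent S v w ->
  exists2 E, is_edge (conv_hull S) E &
    forall t : R, 0 <= t -> t <= 1 -> E (v + t *: (w - v)).
Proof.
move=> uS [vS wS vw [f [fvw fS]]].
have hullE x : conv_hull S x <-> hull S x by rewrite conv_hullP undup_id.
have fmin s : s \in S -> ev f v <= ev f s.
  have [->//|sv] := eqVneq s v; have [->|sw] := eqVneq s w.
    by rewrite fvw.
  by move=> sS; rewrite ltW // fS.
pose E := [set x | conv_hull S x /\ forall y, conv_hull S y -> (f x : R) <= (f y : R)].
have Et t : 0 <= t -> t <= 1 -> E (v + t *: (w - v)).
  move=> t0 t1; split; first by apply/hullE; apply: hull_segment.
  move=> y /hullE; rewrite -[X in X <= _]/(ev f _) evD evZ evB fvw subrr mulr0 addr0.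
  by rewrite -fvw; apply: hull_min.
exists E => //; split; first by exists f.
apply: (@has_dim_line _ v w) => //.
- by have := Et 0; rewrite scale0r addr0; apply.
- by have := Et 1; rewrite scale1r addrC subrK; apply.
- move=> x [/hullE Sx xmin]; apply: (hull_min_face (f := f) (S := S)) => //.
    move=> s sS fs; have [->|sv] := eqVneq s v; first by rewrite subrr mem0v.
    have [->|sw] := eqVneq s w; first exact: memv_line.
    by have := fS s sS sv sw; rewrite fs ltxx.
  apply/le_anti; rewrite (hull_min fmin Sx) andbT; apply: xmin.
  by apply/hullE; apply: hull_mem.
Qed.

Lemma exposed_is_vertex S v : uniq S -> v \in S -> exposed S v ->
  is_vertex (conv_hull S) v.
Proof.
move=> uS vS [f fS].
have hullE x : conv_hull S x <-> hull S x by rewrite conv_hullP undup_id.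
have fmin s : s \in S -> ev f v <= ev f s.
  by have [->//|sv] := eqVneq s v; move=> sS; rewrite ltW // fS.
exists f; apply/seteqP; split=> [_ ->|x [/hullE Sx xmin]].
  split; first by apply/hullE; apply: hull_mem.
  by move=> y /hullE; apply: hull_min.
apply/eqP; rewrite -subr_eq0 -memv0; apply: (hull_min_face (f := f) (S := S)) => //.
  move=> s sS fs; have [->|sv] := eqVneq s v; first by rewrite subrr mem0v.
  by have := fS s sS sv; rewrite fs ltxx.
apply/le_anti; rewrite (hull_min fmin Sx) andbT; apply: xmin.
by apply/hullE; apply: hull_mem.
Qed.

(** Every vertex lies on an edge, so the vertices are themselves among the counted lattice
    points. *)
Lemma polytope_vertices (M P : set V) n d : (0 < d)%N -> \dim {:V} = d ->
  is_lattice M -> lattice_polytope d M P ->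
  (lattice_points_on_edges M P #<= `I_n)%card ->
  exists S v0, [/\ uniq S, v0 \in S, P = conv_hull S,
    forall v, v \in S -> M v & edge_bounded M n S].
Proof.
move=> d_gt0 dimV latM [Pdim [s [sM PE]]] Pn.
have [eta co] := lattice_has_coordinates latM dimV.
have [S [uS subS expS hullS]] := hull_of_exposed (undup_uniq s).
have {}PE : P = conv_hull S.
  rewrite PE; apply/seteqP; split=> x; rewrite !conv_hullP (undup_id uS).
    exact: (hullS x).1.
  exact: (hullS x).2.
have SM v : v \in S -> M v by move=> /subS; rewrite mem_undup; apply: sM.
have hullE x : P x <-> hull S x by rewrite PE conv_hullP undup_id.
have full f u : u \in S -> (forall s, s \in S -> ev f s = ev f u) -> f = 0.
  move=> uS' fS; have fP x : P x -> ev f x = ev f u.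
    move=> /hullE[c [c0 c1 ->]]; rewrite ev_sum -[RHS]mul1r -c1 mulr_suml.
    by apply: eq_big_seq => v vS; rewrite evZ fS.
  have fA x : aff_hull P x -> ev f x = ev f u.
    move=> [k [y [c [Py c1 ->]]]]; rewrite ev_sum -[RHS]mul1r -c1 mulr_suml.
    by apply: eq_bigr => i _; rewrite evZ fP.
  have allx x : ev f x = ev f u by apply: fA; rewrite (has_dim_full _ dimV).1.
  by apply: functional_eq0 => x; rewrite allx -(allx 0) ev0.
have [v0 v0S] : exists v0, v0 \in S.
  have [x Ax] : exists x, aff_hull P x by exists 0; rewrite (has_dim_full _ dimV).1.
  case: Ax => k [y [c [Py c1 _]]].
  case: k y c Py c1 => [|k] y c Py c1.
    by move: c1; rewrite big_ord0 => /esym/eqP; rewrite oner_eq0.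
  have /hullE[a [_ a1 _]] := Py ord0.
  case: (S) a1 => [|v S' _]; last by exists v; rewrite mem_head.
  by rewrite big_nil => /esym/eqP; rewrite oner_eq0.
have edge_at v : v \in S -> exists w, adjacent S v w.
  move=> vS; have [u uS' uv] : exists2 u, u \in S & u != v.
    apply: contrapT => none.
    have Sv u : u \in S -> u = v.
      by move=> uS'; apply/eqP; apply: contrapT => /negP h; apply: none; exists u.
    have k0 : 'I_d by exists 0.
    have e0 : eta k0 = 0 by apply: (full _ v vS) => u /Sv->.
    have [w wE] := coord_surj co (fun=> 1).
    by have := wE k0; rewrite e0 ev0f => /esym/eqP; rewrite oner_eq0.
  exact: exists_edge expS vS uS' uv.
exists S, v0; split=> //; split=> //.
- apply: (card_le_witness (g := nth 0 S) Pn) => [i iS|i j iS jS /eqP].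
    split; first by apply: SM; apply: mem_nth.
    have [w vw] := edge_at _ (mem_nth 0 iS).
    have [E EP Et] := adjacent_edge uS vw; exists E; first by rewrite PE.
    by have := Et 0 (lexx 0) ler01; rewrite scale0r addr0.
  by rewrite nth_uniq // => /eqP.
- by move=> v w /SM Mv /SM Mw; apply: lattice_sub co Mv Mw.
- move=> v w z r vw Mz wE; rewrite ltNge; apply/negP => nr.
  have [vS wS nvw _] := vw; have [E EP Et] := adjacent_edge uS vw.
  have z0 : z != 0.
    by apply: contraNneq nvw => z0; rewrite eq_sym -subr_eq0 wE z0 scaler0.
  (* An edge of length at least [n] in units of [z] contains the [n.+1] lattice points [v + z *+ i]
     with [i] up to [n]. *)
  suff : (n.+1 <= n)%N by rewrite ltnn.
  apply: (card_le_witness (g := fun i => v + z *+ i) Pn) => [i iS|i j _ _ /addrI/eqP].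
    split; first exact: lattice_addMn co (SM v vS) Mz.
    exists E; first by rewrite PE.
    have i_le : i%:R <= r by apply: le_trans nr; rewrite ler_nat -ltnS.
    have [i0|i_gt0] := posnP i.
      by have := Et 0 (lexx 0) ler01; rewrite scale0r i0 mulr0n.
    have r_gt0 : 0 < r by apply: lt_le_trans i_le; rewrite ltr0n.
    have := Et (i%:R / r); rewrite wE scalerA divfK ?gt_eqF // scaler_nat.
    by apply; rewrite ?divr_ge0 ?(ltW r_gt0) // ler_pdivrMr ?mul1r.
  rewrite -!scaler_nat -subr_eq0 -scalerBl scaler_eq0 (negbTE z0) orbF subr_eq0.
  by rewrite eqr_nat => /eqP.
Qed.

Lemma hull_affine_image S (f g : V -> V) x : cancel f g -> uniq S ->
  (forall c : V -> R, \sum_(v <- S) c v = 1 ->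
    f (\sum_(v <- S) c v *: v) = \sum_(v <- S) c v *: f v) ->
  hull S x -> hull (map f S) (f x).
Proof.
move=> fK uS faff [c [c0 c1 ->]]; exists (c \o g); split.
- by move=> v; apply: c0.
- by rewrite big_map -c1; apply: eq_bigr => v _; rewrite /= fK.
- by rewrite big_map faff //; apply: eq_bigr => v _; rewrite /= fK.
Qed.

End Polytopes.

Theorem theorem20 (R : realType) (n d : nat) (hd : (2 <= d)%N) (hn : (d < n)%N)
    (V : vectType R) (hV : \dim {:V} = d) (M : set V) (hM : is_lattice M)
    (I : finType) (W : I -> vectType R) (L : forall i : I, set (W i))
    (C : forall i : I, set (W i))
    (hF : forall i : I, lattice_cone d (L i) (C i)) :
  exists (k : nat) (Q : 'I_k -> set V),
    (forall j : 'I_k, lattice_polytope d M (Q j)) /\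
    forall P : set V,
      lattice_polytope d M P ->
      (lattice_points_on_edges M P #<= `I_n)%card ->
      (forall u : V, is_vertex P u ->
        exists i : I,
          cone_equivalent (dual_lattice M) (normal_cone P u) (L i) (C i)) ->
      exists j : 'I_k, integrally_equivalent M M P (Q j).
Proof.
have [cs csP] := choice (fun i => lattice_cone_frame (hF i)).
have [eta0 co0] := lattice_has_coordinates hM hV.
have [e eE eexp] := dual_basis co0.
have [B BP] := vertices_bounded M n cs.
pose T := {ffun 'I_d -> 'I_(2 * B).+1}.
pose point (t : T) : V := \sum_k grid_coord t k *: e k.
pose QA (A : {set T}) : set V := conv_hull [seq point t | t <- enum A].
(* Representatives are hulls of sets of grid points; those that are not [d]-dimensional are
   discarded. *)
pose G := [set A | `[< lattice_polytope d M (QA A) >]]%SET.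
exists #|G|, (fun j => QA (enum_val j)); split=> [j|P Ppoly Pn Pcones].
  by have := enum_valP j; rewrite inE => /asboolP.
have [S [v0 [uS v0S PE SM eS]]] :=
  polytope_vertices (ltnW hd) hV hM Ppoly Pn.
have frS v : v \in S -> exists i eta, frame M (cs i) S v eta.
  move=> vS; have vP := exposed_is_vertex uS vS (all_exposed eS vS).
  rewrite -PE in vP; have [i iP] := Pcones v vP.
  rewrite PE in iP; have [eta fr] := csP i V M S v hM hV vS uS iP.
  by exists i, eta.
have [i [eta fr]] := frS v0 v0S.
have bound := BP i S v0 eta (conj eS frS) fr v0S.
(* Moves [v0] to the origin and turns the coordinates of the frame at [v0] into those of the fixed
   basis, so the vertices land on grid points. *)
pose f z := \sum_k ev (eta k) (z - v0) *: e k.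
have fE l z : ev (eta0 l) (f z) = ev (eta l) (z - v0).
  rewrite ev_sum (bigD1 l) //= evZ eE eqxx mulr1 big1 ?addr0 // => k kl.
  by rewrite evZ eE (negbTE kl) mulr0.
have eta0_inj x y : (forall l, ev (eta0 l) x = ev (eta0 l) y) -> x = y.
  move=> xy; apply/eqP; rewrite -subr_eq0; apply/eqP/(coord_inj co0) => l.
  by rewrite evB xy subrr.
have eta_inj x y : (forall l, ev (eta l) x = ev (eta l) y) -> x = y.
  move=> xy; apply/eqP; rewrite -subr_eq0; apply/eqP/(coord_inj fr) => l.
  by rewrite evB xy subrr.
have f_sum (k : nat) (y : 'I_k -> V) (c : 'I_k -> R) : \sum_i c i = 1 ->
    f (\sum_i c i *: y i) = \sum_i c i *: f (y i).
  move=> c1; apply: eta0_inj => l; rewrite fE evB !ev_sum.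
  under [RHS]eq_bigr do rewrite evZ fE evB mulrBr.
  rewrite sumrB -mulr_suml c1 mul1r; congr (_ - _).
  by apply: eq_bigr => j _; rewrite evZ.
have /choice[g fg] y : exists z, f z = y.
  have [z zE] := coord_surj fr (fun k => ev (eta0 k) y).
  by exists (z + v0); apply: eta0_inj => l; rewrite fE addrK zE.
have f_inj : injective f.
  move=> x y xy; apply: eta_inj => l; apply/eqP.
  by rewrite -(subrK (ev (eta l) v0) (ev (eta l) x)) -evB -fE xy fE evB subrK.
have gf : cancel f g by move=> x; apply: f_inj; rewrite fg.
have M_f z : M (f z) <-> M z.
  have Mv0 := SM v0 v0S; have N0 : M (z - v0) <-> M z.
    split=> h; last exact: lattice_sub co0 Mv0 h.
    by rewrite -[z](subrK v0) addrC; apply: (lattice_addMn 1 co0 Mv0 h).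
  rewrite -N0 (coord_lattice co0) (coord_lattice fr).
  by split=> h k; have := h k; rewrite fE.
pose A : {set T} := [set t | point t \in map f S]%SET.
have AE : undup [seq point t | t <- enum A] =i map f S.
  move=> y; rewrite mem_undup; apply/mapP/idP => [[t]|yS].
    by rewrite mem_enum inE => tA ->.
  have [v vS yE] := mapP yS.
  have [k|k|t tE] := grid_coordP (B := B) (z := fun k => ev (eta0 k) y).
  - by rewrite yE fE; exact: (coord_lattice fr _).1 (lattice_diff eS v0S vS) k.
  - by rewrite yE fE; apply: bound.
  have yt : y = point t by rewrite (eexp y); apply: eq_bigr => k _; rewrite tE.
  by exists t => //; rewrite mem_enum inE -yt.
have uf : uniq (map f S) by rewrite map_inj_uniq.
have QE : QA A = f @` P.
  have perm : perm_eq (undup [seq point t | t <- enum A]) (map f S).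
    by apply: uniq_perm => //; apply: undup_uniq.
  have hullE y : QA A y <-> hull (map f S) y.
    rewrite /QA conv_hullP; split=> -[c [c0 c1 ->]]; exists c; split=> //.
    - by rewrite -c1; apply/esym/perm_big.
    - exact: perm_big.
    - by rewrite -c1; apply: perm_big.
    - by apply/esym/perm_big.
  have aff (h : V -> V) (s : seq V) : (forall k (y : 'I_k -> V) (c : 'I_k -> R),
        \sum_i c i = 1 -> h (\sum_i c i *: y i) = \sum_i c i *: h (y i)) ->
      forall c : V -> R, \sum_(v <- s) c v = 1 ->
        h (\sum_(v <- s) c v *: v) = \sum_(v <- s) c v *: h v.
    move=> haff c; have nth_sum (W' : zmodType) (F : V -> W') :
        \sum_(v <- s) F v = \sum_(j < size s) F s`_j.
      by rewrite (big_nth 0) big_mkord.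
    by rewrite !nth_sum => /haff->.
  apply/seteqP; split=> y.
    move=> /hullE Hy; exists (g y) => //; rewrite PE; apply/conv_hullP.
    rewrite undup_id // -[S](mapK gf); apply: hull_affine_image Hy => //.
    apply: aff => k z c c1; apply: f_inj; rewrite fg f_sum //.
    by apply: eq_bigr => j _; rewrite fg.
  move=> [x Px <-]; apply/hullE.
  move: Px; rewrite PE => /conv_hullP; rewrite undup_id // => Sx.
  by apply: hull_affine_image gf uS _ Sx; apply: aff.
have PT : aff_hull P = setT by apply/(has_dim_full _ hV); case: Ppoly.
have QT : aff_hull (f @` P) = setT.
  apply/seteqP; split=> // y _.
  have [k [x [c [Px c1 gyE]]]] : aff_hull P (g y) by rewrite PT.
  exists k, (f \o x), c; split=> //; first by move=> j; exists (x j).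
  by rewrite -f_sum // -gyE fg.
have AG : A \in G.
  rewrite inE; apply/asboolP; split; first by apply/(has_dim_full _ hV); rewrite QE.
  exists [seq point t | t <- enum A]; split=> // x.
  by rewrite -mem_undup AE => /mapP[v vS ->]; apply/M_f/SM.
exists (enum_rank_in AG A); rewrite enum_rankK_in // QE.
exists f; split=> //.
- move=> x y t _ _; clearbody f.
  have := f_sum 2 (fun i => if i == ord0 then x else y)
    (fun i => if i == ord0 then t else 1 - t).
  rewrite !big_ord_recl !big_ord0 /= !addr0 => -> //.
  by rewrite addrC subrK.
- by move=> x _; rewrite QT.
- rewrite PT QT !setIT; split.
  + by move=> x /M_f.
  + by move=> x y _ _; apply: f_inj.
  + by move=> y My; exists (g y); rewrite ?fg //; apply/M_f; rewrite fg.
Qed.
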